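(* Let $\alpha>0$ be fixed. For any decreasing function $s:(0,\infty)\to(0,\infty)$ such that $\lim_{t\to\infty}s(t)=0$ and $\int_1^\infty s(t)\,dt=\infty$, there exists a positive superharmonic function $\varphi$ on $U_+$ such that $$\left|\{\xi\in\mathbb{R}: M\varphi(\xi)>t\}\right|\le s(t)\quad\text{for all } t>0 \text{ large enough},$$ but there does not exist any harmonic function $h$ on $U_+$ such that $h(z)\ge\varphi(z)$ for all $z\in U_+$.
   Context: $U_+=\{z\in\mathbb{C}:\operatorname{Im}z>0\}$. For $t\in\mathbb{R}$, the Stolz angle with vertex $t$ is $\Gamma_\alpha(t)=\{z=x+iy\in U_+: |x-t|\le\alpha y\}$, with fixed aperture $\alpha$. For a nonnegative function $f$ on $U_+$, the nontangential maximal function is $Mf(t)=\sup_{\Gamma_\alpha(t)}f$, $t\in\mathbb{R}$. $|\cdot|$ denotes one-dimensional Lebesgue measure on $\mathbb{R}$. *)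

(* Defs.v *)
(* MathComp-Analysis; the complex plane is R * R, z = x + iy being (x, y). *)
From HB Require Import structures.
From mathcomp Require Import all_boot all_order all_algebra.
From mathcomp Require Import all_classical all_reals all_analysis.

Set Implicit Arguments.
Unset Strict Implicit.
Unset Printing Implicit Defensive.

Import Order.TTheory GRing.Theory Num.Theory.
Import numFieldNormedType.Exports.

Local Open Scope classical_set_scope.
Local Open Scope ring_scope.

Section Defs.
Context {R : realType}.
Implicit Types (D : set (R * R)) (w z : R * R).

Definition upper_half_plane : set (R * R) := [set z | 0 < z.2].

Definition stolz_angle (alpha t : R) : set (R * R) :=
  upper_half_plane `&` [set z | `|z.1 - t| <= alpha * z.2].

Definition nontangential_max (alpha : R) (f : R * R -> \bar R) (t : R) :
    \bar R :=
  ereal_sup (f @` stolz_angle alpha t).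

(* The product norm on R * R is the sup norm, hence the explicit formula for
   Euclidean discs. *)
Definition closed_disc w (r : R) : set (R * R) :=
  [set z | (z.1 - w.1) ^+ 2 + (z.2 - w.2) ^+ 2 <= r ^+ 2].

Definition circle_point w (r theta : R) : R * R :=
  (w.1 + r * cos theta, w.2 + r * sin theta).

Definition circle_mean (u : R * R -> \bar R) w (r : R) : \bar R :=
  (((2 * pi)^-1)%:E *
   \int[lebesgue_measure]_(theta in `[0%R, (2 * pi)%R])
     u (circle_point w r theta))%E.

(* D is meant to be open and connected: "not identically +oo" is required on
   D as a whole, not on each component.  Values of u outside D are
   irrelevant: points outside D are isolated in [subspace D]. *)
Definition superharmonic D (u : R * R -> \bar R) : Prop :=
  [/\ @lower_semicontinuous (subspace D) R u,
      forall z, D z -> (-oo < u z)%E,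
      exists2 z, D z & (u z < +oo)%E &
      forall w r, 0 < r -> closed_disc w r `<=` D ->
        (circle_mean u w r <= u w)%E].

Definition dx (h : R * R -> R) : R * R -> R := fun z => 'D_((1, 0) : R * R) h z.
Definition dy (h : R * R -> R) : R * R -> R := fun z => 'D_((0, 1) : R * R) h z.

Definition C1_on D (h : R * R -> R) : Prop :=
  forall z, D z ->
    [/\ derivable h z ((1, 0) : R * R), derivable h z ((0, 1) : R * R),
        {for z, continuous (dx h)} & {for z, continuous (dy h)}].

Definition C2_on D (h : R * R -> R) : Prop :=
  [/\ C1_on D h, C1_on D (dx h) & C1_on D (dy h)].

Definition harmonic_on D (h : R * R -> R) : Prop :=
  C2_on D h /\ forall z, D z -> dx (dx h) z + dy (dy h) z = 0.

End Defs.

(* Main.v *)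
Require Import Defs.
From HB Require Import structures.
From mathcomp Require Import all_boot all_order all_algebra.
From mathcomp Require Import all_classical all_reals all_analysis.
From mathcomp Require Import measurable_realfun ring lra.
Import Order.TTheory GRing.Theory Num.Theory.
Import numFieldNormedType.Exports.
Local Open Scope classical_set_scope.
Local Open Scope ring_scope.

Set Implicit Arguments.
Unset Strict Implicit.
Unset Printing Implicit Defensive.

(** Fix a small height [v].  At the points [w_i = (i v, v)] we put truncated
    Green potentials of height [T_i] and of support so tiny that they stay below
    an arbitrarily small constant outside the squares of side [v] about the
    [w_i] (a logarithm has a bounded profile at the scale [v], whatever its
    peak).  The numbers [T_i] are a discrete decreasing rearrangement of [s], so
    that the union of the shadows of the squares with [T_i > t - 1] is contained
    in one interval of length [s t], whereas [v * \sum_i T_i] is as large as we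
    wish because the integral of [s] diverges.  The function sought is the sum
    of infinitely many such layers, at heights decreasing at least like [4^-j]:
    their squares are pairwise disjoint and their shadows all lie in the same
    interval.

    A positive harmonic function [h], on the other hand, satisfies
    [v * \sum_i h w_i <= C] with [C] independent of [v].  Testing the equation
    against [cut (x / Z) * ramp (y - y0)] on a rectangle of lower side [y = y0]
    bounds the integral of [h] on horizontal segments uniformly in [y0], and
    testing it against a regularised logarithm yields the sub-mean value
    inequality which passes from segments to the points [w_i]. *)

(** The construction rests on an asymmetry. A superharmonic function can rise to any height around a
    point with as little Riesz mass as one likes, since a logarithmic pole is infinite: the weight
    [d] and the peak [T] of a bump are independent. So the tails of all bumps add up to at most 1,
    and only the peaks and the size [v] of the squares are seen by the maximal function. A positive
    harmonic function cannot spike: if [h w_i >= T_i], then its integral over a square of side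
    comparable to [v] about [w_i] is at least a constant times [v^2 T_i].

    One layer would not do, as it is bounded on the half-plane and so lies below a constant. Layers
    with [v * \sum_i T_i] arbitrarily large are needed, and the bound on [h] has to be uniform as
    [v] tends to 0. The Poisson representation would supply it through the boundary measure of [h];
    explicit test functions in Green's identity take its place, with only the fundamental theorem of
    calculus and Fubini's theorem behind them. *)

(** * Differentiation rules and primitives in one variable *)

Section Calculus.
Context {R : realType}.
Implicit Types (f g : R -> R) (x a b : R).

(* The library states these rules for the pointwise operations on functions,
   which [apply] does not find in a lambda-abstraction. *)
Lemma is_derive1C c x : is_derive x 1 (fun _ : R => c) (0 : R).
Proof. exact: is_derive_cst. Qed.

Lemma is_derive1I x : is_derive x 1 (fun t : R => t) (1 : R).
Proof. exact: is_derive_id. Qed.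

Lemma is_derive1D f g x a b : is_derive x 1 f a -> is_derive x 1 g b ->
  is_derive x 1 (fun t => f t + g t) (a + b).
Proof. by move=> fa gb; exact: is_deriveD. Qed.

Lemma is_derive1N f x a : is_derive x 1 f a -> is_derive x 1 (fun t => - f t) (- a).
Proof. by move=> fa; exact: is_deriveN. Qed.

Lemma is_derive1B f g x a b : is_derive x 1 f a -> is_derive x 1 g b ->
  is_derive x 1 (fun t => f t - g t) (a - b).
Proof. by move=> fa gb; exact: is_deriveB. Qed.

Lemma is_derive1M f g x a b : is_derive x 1 f a -> is_derive x 1 g b ->
  is_derive x 1 (fun t => f t * g t) (a * g x + f x * b).
Proof.
move=> fa gb; apply: is_derive_eq (is_deriveM fa gb) _.
by rewrite /GRing.scale/=; ring.
Qed.

Lemma is_derive1X f n x a : is_derive x 1 f a ->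
  is_derive x 1 (fun t => f t ^+ n.+1) (n.+1%:R * f x ^+ n * a).
Proof. move=> fa; elim: n => [|n IH].
  by rewrite expr0 mulr1 mul1r; under eq_fun do rewrite expr1.
under eq_fun do rewrite exprS.
by apply: is_derive_eq (is_derive1M fa IH) _; rewrite exprS -[in RHS]natr1; ring.
Qed.

Lemma is_derive1_comp_fun f g x a b : is_derive (g x) 1 f a -> is_derive x 1 g b ->
  is_derive x 1 (fun t => f (g t)) (a * b).
Proof. exact: is_derive1_comp. Qed.

Lemma is_derive1_ln_comp f x a : 0 < f x -> is_derive x 1 f a ->
  is_derive x 1 (fun t => ln (f t)) (a / f x).
Proof.
by move=> fx fa; rewrite mulrC; apply: is_derive1_comp_fun => //; exact: is_derive1_ln.
Qed.

Lemma is_derive1_continuous f x a : is_derive x 1 f a -> {for x, continuous f}.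
Proof. by case=> df _; apply/differentiable_continuous/derivable1_diffP. Qed.

Lemma integral_derive F f a b : a < b ->
  (forall x, a <= x <= b -> is_derive x 1 F (f x)) ->
  (forall x, a <= x <= b -> {for x, continuous f}) ->
  (\int[lebesgue_measure]_(x in `[a, b]) (f x)%:E = (F b - F a)%:E)%E.
Proof.
move=> ab dF cf; rewrite (@continuous_FTC2 _ f F)//.
- apply/continuous_in_subspaceT => x; rewrite inE/= in_itv/=; exact: cf.
- have ha : a <= a <= b by rewrite lexx ltW.
  have hb : a <= b <= b by rewrite lexx ltW.
  split.
  + move=> x; rewrite in_itv/= => /andP[ax xb].
    have [] := dF x; by [rewrite !ltW|].
  + apply: cvg_at_right_filter; exact: (is_derive1_continuous (dF a ha)).
  + apply: cvg_at_left_filter; exact: (is_derive1_continuous (dF b hb)).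
- move=> x; rewrite in_itv/= => /andP[ax xb]; rewrite derive1E.
  have [] := dF x; by [rewrite !ltW|].
Qed.

Lemma exists_primitive f a : continuous f ->
  exists F, forall x, a < x -> is_derive x 1 F (f x).
Proof.
move=> cf; exists (fun x => \int[lebesgue_measure]_(t in `[a, x]) f t) => x ax.
have h : lebesgue_measure.-integrable `[a, x + 1] (EFin \o f).
  apply: continuous_compact_integrable; first exact: segment_compact.
  exact: continuous_subspaceT.
have [||h1 h2] := @continuous_FTC1_closed R f a x (x + 1) _ h ax.
- by rewrite ltrDl.
- exact: cf.
by apply: DeriveDef => //; rewrite -derive1E.
Qed.

(** With primitives [F] of [f] and [G] of [g], both [G (2 * t) / 2] and [F t + F (t + pi)] are
    primitives of [g (2 * t)]. Comparing their increments over [[0, pi]] replaces a change of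
    variables. *)
Lemma integral_circle_halves f (g : R -> R) : continuous f -> continuous g ->
  (forall t, f t + f (t + pi) = g (2 * t)) ->
  2 * \int[lebesgue_measure]_(t in `[0, 2 * pi]) f t =
  \int[lebesgue_measure]_(t in `[0, 2 * pi]) g t.
Proof.
move=> cf cg fg.
(* The base point [-1] lies strictly left of [0], so the primitives have two-sided derivatives at
   [0] as well. *)
have [F dF] := exists_primitive (-1) cf.
have [G dG] := exists_primitive (-1) cg.
have p0 := @pi_gt0 R.
have p2 : 0 < 2 * (pi : R) by rewrite mulr_gt0.
have IF : (\int[lebesgue_measure]_(t in `[0%R, (2 * pi)%R]) (f t)%:E =
    (F (2 * pi) - F 0)%:E)%E.
  apply: integral_derive => // x /andP[x0 _]; last exact: cf.
  by apply: dF; rewrite (lt_le_trans _ x0)// ltrN10.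
have IG : (\int[lebesgue_measure]_(t in `[0%R, (2 * pi)%R]) (g t)%:E =
    (G (2 * pi) - G 0)%:E)%E.
  apply: integral_derive => // x /andP[x0 _]; last exact: cg.
  by apply: dG; rewrite (lt_le_trans _ x0)// ltrN10.
rewrite /Rintegral IF IG.
have E : (\int[lebesgue_measure]_(t in `[0%R, pi]) (g (2 * t))%:E =
  (G (2 * pi) / 2 - G (2 * 0) / 2)%:E)%E.
  apply: (@integral_derive (fun t => G (2 * t) / 2)) => //.
  - move=> x /andP[x0 _]; apply: is_derive_eq.
      apply: (is_derive1M _ (is_derive1C 2^-1 x)); apply: is_derive1_comp_fun.
        by apply: dG; nra.
    by rewrite /GRing.scale/=; field.
  - move=> x _; apply: continuous_comp; last exact: cg.
    by apply: (@mulrl_continuous R).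
have E2 : (\int[lebesgue_measure]_(t in `[0%R, pi]) (g (2 * t))%:E =
  (F pi + F (pi + pi) - (F 0 + F (0 + pi)))%:E)%E.
  apply: (@integral_derive (fun t => F t + F (t + pi))) => //.
  - move=> x /andP[x0 _]; rewrite -fg; apply: is_derive_eq.
      apply: is_derive1D; first by apply: dF; lra.
      apply: is_derive1_comp_fun; first by apply: dF; lra.
    by rewrite /GRing.scale/=; ring.
  - move=> x _; apply: continuous_comp; last exact: cg.
    by apply: (@mulrl_continuous R).
move: E; rewrite E2 => -[]; have -> : pi + pi = 2 * pi :> R by ring.
rewrite mulr0 add0r /=; lra.
Qed.

End Calculus.

(** * Pointwise continuity of real-valued expressions *)

Section Continuity.
Context {R : realType} {T : topologicalType}.
Implicit Types (f g : T -> R) (x : T).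

Lemma continuous_at_cst (c : R) x : continuous_at x (fun _ : T => c).
Proof. exact: cst_continuous. Qed.

Lemma continuous_atD f g x : continuous_at x f -> continuous_at x g ->
  continuous_at x (fun y => f y + g y).
Proof. by move=> cf cg; exact: (@continuousD _ _ _ f g). Qed.

Lemma continuous_atN f x : continuous_at x f -> continuous_at x (fun y => - f y).
Proof. by move=> cf; exact: (@continuousN _ _ _ f). Qed.

Lemma continuous_atB f g x : continuous_at x f -> continuous_at x g ->
  continuous_at x (fun y => f y - g y).
Proof. by move=> cf cg; exact: (@continuousB _ _ _ f g). Qed.

Lemma continuous_atM f g x : continuous_at x f -> continuous_at x g ->
  continuous_at x (fun y => f y * g y).
Proof. by move=> cf cg; exact: (@continuousM _ _ f g). Qed.

Lemma continuous_atX f n x : continuous_at x f ->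
  continuous_at x (fun y => f y ^+ n).
Proof.
move=> cf; elim: n => [|n IH].
  have -> : (fun y => f y ^+ 0) = (fun _ => 1) by apply/funext => y; rewrite expr0.
  exact: continuous_at_cst.
have -> : (fun y => f y ^+ n.+1) = (fun y => f y * f y ^+ n).
  by apply/funext => y; rewrite exprS.
exact: continuous_atM.
Qed.

Lemma continuous_atV f x : f x != 0 -> continuous_at x f ->
  continuous_at x (fun y => (f y)^-1).
Proof. by move=> f0 cf; exact: (@continuousV _ _ f). Qed.

Lemma continuous_at_ln f x : 0 < f x -> continuous_at x f ->
  continuous_at x (fun y => ln (f y)).
Proof. by move=> fx cf; apply: continuous_comp => //; exact: continuous_ln. Qed.

Lemma continuous_at_pair f g x : continuous_at x f -> continuous_at x g ->
  continuous_at x (fun y => (f y, g y)).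
Proof. by move=> cf cg; exact: (cvg_pair cf cg). Qed.

Lemma continuous_at_comp (U : topologicalType) (g : U -> R) (f : T -> U) x :
  continuous_at x f -> continuous_at (f x) g ->
  continuous_at x (fun y => g (f y)).
Proof. by move=> cf cg; exact: (@continuous_comp _ _ _ f g). Qed.

End Continuity.

(** * Logarithmic means over circles *)

Section CircleMean.
Context {R : realType}.
Implicit Types (a b t r : R).

(* The square of the modulus of [1 + (a - i b) e^(i t)]. *)
Definition trig_kernel a b t : R :=
  1 + (a ^+ 2 + b ^+ 2) + 2 * (a * cos t + b * sin t).

Lemma trig_sq_le a b t : (a * cos t + b * sin t) ^+ 2 <= a ^+ 2 + b ^+ 2.
Proof.
have e := cos2Dsin2 t; have h := sqr_ge0 (a * sin t - b * cos t).
have -> : a ^+ 2 + b ^+ 2 =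
  (a * cos t + b * sin t) ^+ 2 + (a * sin t - b * cos t) ^+ 2.
  by rewrite -[LHS]mulr1 -e; ring.
by rewrite lerDl.
Qed.

Lemma trig_kernel_bounds a b t r : 0 <= r < 1 -> a ^+ 2 + b ^+ 2 <= r ^+ 2 ->
  (1 - r) ^+ 2 <= trig_kernel a b t <= 4.
Proof.
move=> /andP[r0 r1] abr; have := trig_sq_le a b t; rewrite /trig_kernel.
move: (a * cos t + b * sin t) (a ^+ 2 + b ^+ 2) abr => u q qr uq.
have ur : `|u| <= r by rewrite -(@ler_sqr _ `|u|) ?nnegrE// real_normK ?num_real// (le_trans uq).
move: ur; rewrite ler_norml => /andP[u1 u2].
apply/andP; split; nra.
Qed.

Lemma trig_kernel_cont a b : continuous (trig_kernel a b).
Proof.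
move=> t; rewrite /trig_kernel; apply: continuous_atD; first exact: continuous_at_cst.
apply: continuous_atM; first exact: continuous_at_cst.
apply: continuous_atD; apply: continuous_atM; [exact: continuous_at_cst|exact: continuous_cos| |];
  [exact: continuous_at_cst|exact: continuous_sin].
Qed.



Local Notation circ := [set` `[0%R, (2 * pi)%R]].

Lemma pi2_gt0 : 0 < 2 * (pi : R).
Proof. by rewrite mulr_gt0// pi_gt0. Qed.

Lemma integrable_circle (f : R -> R) : continuous f ->
  lebesgue_measure.-integrable circ (EFin \o f).
Proof.
move=> cf; apply: continuous_compact_integrable; first exact: segment_compact.
exact: continuous_subspaceT.
Qed.

Lemma Rintegral_circle_cst c : \int[lebesgue_measure]_(t in circ) c = c * (2 * pi) :> R.
Proof.
rewrite Rintegral_cst//= lebesgue_measure_itv/= lte_fin pi2_gt0 /=.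
by rewrite subr0.
Qed.

Lemma Rintegral_circle_bound (f : R -> R) K : continuous f -> 
  (forall t, `|f t| <= K) ->
  `|\int[lebesgue_measure]_(t in circ) f t| <= K * (2 * pi).
Proof.
move=> cf fK; apply: le_trans (le_normr_Rintegral _ (integrable_circle cf)) _ => //.
rewrite -Rintegral_circle_cst; apply: le_Rintegral => //.
- apply: (@integrable_circle (fun t => `|f t|)) => t; apply: continuous_comp; first exact: cf.
  exact: norm_continuous.
- by apply: (@integrable_circle (cst K)) => t; exact: cst_continuous.
Qed.

(** Squared moduli in [(1 + w e^(i t)) (1 - w e^(i t)) = 1 - w^2 e^(2 i t)] for [w = a - i b];
    adding [pi] to [t] flips the sign of [e^(i t)]. *)
Lemma trig_kernel_double a b t :
  trig_kernel a b t * trig_kernel a b (t + pi) =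
  trig_kernel (b ^+ 2 - a ^+ 2) (- (2 * (a * b))) (2 * t).
Proof.
rewrite /trig_kernel cosDpi sinDpi.
have -> : 2 * t = t + t by ring.
rewrite cosD sinD.
have e : sin t ^+ 2 = 1 - cos t ^+ 2 by rewrite -(cos2Dsin2 t); ring.
have -> : cos t * cos t - sin t * sin t = 2 * cos t ^+ 2 - 1.
  by rewrite -[sin t * _]expr2 e; ring.
transitivity ((1 + (a ^+ 2 + b ^+ 2)) ^+ 2 -
  4 * (a ^+ 2 * cos t ^+ 2 + b ^+ 2 * sin t ^+ 2 + 2 * a * b * cos t * sin t)).
  by ring.
by rewrite e; ring.
Qed.

(* By [trig_kernel_double], twice the integral at [w = a - i b] is the integral
   at [- w^2]; iterating, a bounded quantity is divided by [2 ^ n]. *)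
Lemma log_trig_kernel_mean a b : a ^+ 2 + b ^+ 2 < 1 ->
  \int[lebesgue_measure]_(t in circ) ln (trig_kernel a b t) = 0.
Proof.
move=> ab1; set r := Num.sqrt (a ^+ 2 + b ^+ 2).
have ab0 : 0 <= a ^+ 2 + b ^+ 2 by rewrite addr_ge0 ?sqr_ge0.
have r01 : 0 <= r < 1.
  by rewrite sqrtr_ge0/= -sqrtr1 ltr_sqrt.
have abr : a ^+ 2 + b ^+ 2 <= r ^+ 2 by rewrite sqr_sqrtr.
(* From here [r] is only an upper bound for the modulus of [w]: it remains one along the iteration
   of [w -> - w^2], so the constant [K] below serves every step. *)
move: r r01 abr {ab1 ab0} => r r01 abr.
have [r0 r1] := andP r01.
pose K := 4 - 2 * ln (1 - r).
have pos x y t : x ^+ 2 + y ^+ 2 <= r ^+ 2 -> 0 < trig_kernel x y t.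
  move=> /(trig_kernel_bounds t r01) /andP[+ _]; apply: lt_le_trans.
  by rewrite exprn_gt0// subr_gt0.
have cl x y : x ^+ 2 + y ^+ 2 <= r ^+ 2 -> continuous (fun t => ln (trig_kernel x y t)).
  by move=> h t; apply: continuous_at_ln; [exact: pos|exact: trig_kernel_cont].
have bd x y t : x ^+ 2 + y ^+ 2 <= r ^+ 2 -> `|ln (trig_kernel x y t)| <= K.
  move=> h; have /andP[k1 k2] := trig_kernel_bounds t r01 h.
  have k0 := pos _ _ t h.
  have l4 : ln (trig_kernel x y t) <= 4.
    by apply: le_trans k2; apply/ltW/ln_sublinear.
  have l1 : 2 * ln (1 - r) <= ln (trig_kernel x y t).
    rewrite mulr_natl -lnXn ?subr_gt0// ler_ln// posrE exprn_gt0// subr_gt0//.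
  have lr : ln (1 - r) <= 0 by rewrite ln_le0// gerBl.
  by rewrite ler_norml /K; apply/andP; split; lra.
have key n : forall x y, x ^+ 2 + y ^+ 2 <= r ^+ 2 ->
  `|\int[lebesgue_measure]_(t in circ) ln (trig_kernel x y t)| <= K * (2 * pi) / 2 ^+ n.
  elim: n => [|n IH] x y xy.
    by rewrite expr0 divr1; apply: Rintegral_circle_bound => //; [exact: cl|move=> t; exact: bd].
  have xy' : (y ^+ 2 - x ^+ 2) ^+ 2 + (- (2 * (x * y))) ^+ 2 <= r ^+ 2.
    have -> : (y ^+ 2 - x ^+ 2) ^+ 2 + (- (2 * (x * y))) ^+ 2 = (x ^+ 2 + y ^+ 2) ^+ 2 by ring.
    have := addr_ge0 (sqr_ge0 x) (sqr_ge0 y).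
    move: (x ^+ 2 + y ^+ 2) xy => q qr q0; apply: le_trans (qr).
    have : r ^+ 2 <= 1 by rewrite expr_le1 // ltW.
    by move=> r21; rewrite expr2 ler_piMl// (le_trans qr).
  have := @integral_circle_halves R _ _ (cl _ _ xy) (cl _ _ xy').
  move=> /(_ _)/wrap[t|E].
    by rewrite -lnM ?posrE ?pos// trig_kernel_double.
  have := IH _ _ xy'; rewrite -E normrM (ger0_norm (ler0n _ 2)) exprS invfM.
  lra.
apply/eqP; rewrite -normr_eq0 eq_le normr_ge0 andbT.
have K0 : 0 <= K * (2 * pi) by rewrite mulr_ge0 ?(ltW pi2_gt0)// (le_trans _ (bd a b 0 abr)).
apply/ler_addgt0Pl => e e0; rewrite addr0.
have [n hn] : exists n : nat, K * (2 * pi) / e < n%:R.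
  by exists (Num.truncn (K * (2 * pi) / e)).+1; exact: truncnS_gt.
apply: le_trans (key n a b abr) _.
rewrite ler_pdivrMr ?exprn_gt0// -ler_pdivrMl// mulrC.
apply/ltW/(lt_trans hn); rewrite -natrX ltr_nat; exact: ltn_expl.
Qed.

End CircleMean.

(** * Circle means of logarithms and the regularised Green function *)

Section Bump.
Context {R : realType}.
Local Notation circ := [set` `[0%R, (2 * pi)%R]].
Implicit Types (x v d e p q r t : R) (w z : R * R).

(** Factoring out [M] leaves [trig_kernel (C / (2 M)) (D / (2 M))], whose logarithm has mean zero.
    For a given constant term [A], the number [M] is the larger root of
    [M^2 - A M + (C^2 + D^2) / 4 = 0]. *)
Lemma log_trig_mean (M C D : R) : 0 < M -> C ^+ 2 + D ^+ 2 < 4 * M ^+ 2 ->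
  \int[lebesgue_measure]_(t in circ)
    ln (M + (C ^+ 2 + D ^+ 2) / (4 * M) + (C * cos t + D * sin t)) =
  2 * pi * ln M.
Proof.
move=> M0 CD; pose a := C / (2 * M); pose b := D / (2 * M).
have Mn0 : M != 0 by rewrite gt_eqF.
have qE : a ^+ 2 + b ^+ 2 = (C ^+ 2 + D ^+ 2) / (4 * M ^+ 2) by rewrite /a /b; field.
have ab1 : a ^+ 2 + b ^+ 2 < 1.
  by rewrite qE ltr_pdivrMr ?mul1r// mulr_gt0// exprn_gt0.
have kpos t : 0 < trig_kernel a b t.
  rewrite /trig_kernel; have := trig_sq_le a b t.
  by move: (a * _ + _) (a ^+ 2 + _) ab1 => u q q1 uq; nra.
transitivity (\int[lebesgue_measure]_(t in circ) (ln M + ln (trig_kernel a b t))).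
  apply: eq_Rintegral => t _; rewrite -lnM ?posrE//; congr ln.
  by rewrite /trig_kernel qE /a /b; field.
have cl : continuous (fun t => ln (trig_kernel a b t)).
  by move=> t; apply: continuous_at_ln; [exact: kpos|exact: trig_kernel_cont].
rewrite RintegralD//=; [|apply: integrable_circle|exact: integrable_circle].
  by rewrite log_trig_kernel_mean// addr0 Rintegral_circle_cst mulrC.
by move=> t; exact: cst_continuous.
Qed.

Definition sqdist_circle p q r t : R := (p + r * cos t) ^+ 2 + (q + r * sin t) ^+ 2.

Lemma sqdist_circleE p q r t : sqdist_circle p q r t =
  p ^+ 2 + q ^+ 2 + r ^+ 2 + (2 * r * p * cos t + 2 * r * q * sin t).
Proof.
have e : r ^+ 2 = r ^+ 2 * (cos t ^+ 2 + sin t ^+ 2) by rewrite cos2Dsin2 mulr1.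
by rewrite e /sqdist_circle; ring.
Qed.

(** The mean value property of [ln |z|^2] on a disc that misses the origin: here [M = p^2 + q^2],
    and [(C^2 + D^2) / (4 M)] is exactly [r^2]. *)
Lemma log_circle_mean_harmonic p q r : r ^+ 2 < p ^+ 2 + q ^+ 2 ->
  \int[lebesgue_measure]_(t in circ) ln (sqdist_circle p q r t) =
  2 * pi * ln (p ^+ 2 + q ^+ 2).
Proof.
move=> h; have P0 : 0 < p ^+ 2 + q ^+ 2 by apply: le_lt_trans h; exact: sqr_ge0.
rewrite -(@log_trig_mean _ (2 * r * p) (2 * r * q))//; last first.
  have -> : (2 * r * p) ^+ 2 + (2 * r * q) ^+ 2 = 4 * (r ^+ 2 * (p ^+ 2 + q ^+ 2)) by ring.
  by rewrite ltr_pM2l// expr2 ltr_pM2r.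
apply: eq_Rintegral => t _; rewrite sqdist_circleE; congr ln.
have Pn0 : p ^+ 2 + q ^+ 2 != 0 by rewrite gt_eqF.
by field.
Qed.

Lemma log_circle_mean_subharmonic p q r e : 0 < r -> 0 < e ->
  2 * pi * ln (p ^+ 2 + q ^+ 2 + e) <=
  \int[lebesgue_measure]_(t in circ) ln (sqdist_circle p q r t + e).
Proof.
move=> r0 e0; pose P := p ^+ 2 + q ^+ 2; pose A := P + r ^+ 2 + e.
have P0 : 0 <= P by rewrite addr_ge0 ?sqr_ge0.
have rr0 : 0 < r ^+ 2 by rewrite exprn_gt0.
have A0 : 0 < A by rewrite /A; lra.
have dE : A ^+ 2 - 4 * (r ^+ 2 * P) = (P + e - r ^+ 2) ^+ 2 + 4 * (r ^+ 2 * e).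
  by rewrite /A; ring.
have re0 : 0 < r ^+ 2 * e by rewrite mulr_gt0.
have d0 : 0 < A ^+ 2 - 4 * (r ^+ 2 * P).
  by rewrite dE; have := sqr_ge0 (P + e - r ^+ 2); lra.
pose S := Num.sqrt (A ^+ 2 - 4 * (r ^+ 2 * P)).
have SS : S ^+ 2 = A ^+ 2 - 4 * (r ^+ 2 * P) by rewrite sqr_sqrtr// ltW.
have S0 : 0 < S by rewrite sqrtr_gt0.
have SP : P + e - r ^+ 2 <= S.
  apply: le_trans (ler_norm _) _; rewrite -sqrtr_sqr ler_sqrt; last first.
    by rewrite ltW.
  by rewrite dE lerDl; lra.
(* The larger root of [M^2 - A M + r^2 P = 0], as [log_trig_mean] wants. Since [SP] bounds the root
   [S] of the discriminant below by [P + e - r^2], it follows that [M >= P + e], which is the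
   claim. *)
pose M := (A + S) / 2.
have M0 : 0 < M by rewrite /M; lra.
have ME : r ^+ 2 * P = M * (A - M).
  have -> : M * (A - M) = (A ^+ 2 - S ^+ 2) / 4 by rewrite /M; field.
  by rewrite SS; field.
have CD : (2 * r * p) ^+ 2 + (2 * r * q) ^+ 2 = 4 * (r ^+ 2 * P) by rewrite /P; ring.
apply: (@le_trans _ _ (2 * pi * ln M)).
  rewrite ler_pM2l ?pi2_gt0// ler_ln ?posrE// -/P; last by lra.
  by rewrite /M /A; lra.
rewrite -(@log_trig_mean _ (2 * r * p) (2 * r * q))//; last first.
  by rewrite CD ltr_pM2l// ME expr2 ltr_pM2l// /M; lra.
rewrite le_eqVlt; apply/orP; left; apply/eqP.
apply: eq_Rintegral => t _; rewrite sqdist_circleE CD ME; congr ln.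
have Mn0 : M != 0 by rewrite gt_eqF.
rewrite -/P.
have -> : M + 4 * (M * (A - M)) / (4 * M) = A by field.
by rewrite /A; ring.
Qed.

Lemma upper_gt0 z : upper_half_plane z -> 0 < z.2.
Proof. by []. Qed.

(* The regularised Green function of the half-plane with pole [(x, v)].  The
   reflected pole sits at [(x, - 2 v)] instead of [(x, - v)]: this leaves room for
   the regularisation [e <= v ^+ 2] while keeping the function positive. *)
Definition bump x v d e z : R :=
  d * ln (((z.1 - x) ^+ 2 + (z.2 + 2 * v) ^+ 2) /
          ((z.1 - x) ^+ 2 + (z.2 - v) ^+ 2 + e)).

Lemma sqdist_circle_cont p q r e : continuous (fun t => sqdist_circle p q r t + e).
Proof.
move=> t; rewrite /sqdist_circle; apply: continuous_atD; last exact: continuous_at_cst.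
apply: continuous_atD; apply/continuous_atX/continuous_atD; try exact: continuous_at_cst; apply: continuous_atM; try exact: continuous_at_cst.
  exact: continuous_cos.
exact: continuous_sin.
Qed.

Lemma closed_disc_upper w r : 0 < r ->
  closed_disc w r `<=` upper_half_plane -> r < w.2.
Proof.
move=> r0 h; have := h (w.1, w.2 - r); rewrite /closed_disc /upper_half_plane /=.
rewrite subrr expr0n/= add0r addrAC subrr add0r sqrrN lexx => /(_ isT).
by rewrite subr_gt0.
Qed.

(** The logarithm of the numerator has its pole below the half-plane, so its mean is exact; that of
    the regularised denominator has a mean at least its central value, and it enters with a minus
    sign. *)
Lemma circle_mean_bump x v d e w r : 0 < r -> 0 < d -> 0 < e -> 0 < v -> r < w.2 ->
  (circle_mean (fun z => (bump x v d e z)%:E) w r <= (bump x v d e w)%:E)%E.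
Proof.
move=> r0 d0 e0 v0 rw; rewrite /circle_mean.
pose f1 t := ln (sqdist_circle (w.1 - x) (w.2 + 2 * v) r t).
pose f2 t := ln (sqdist_circle (w.1 - x) (w.2 - v) r t + e).
have rq : r ^+ 2 < (w.1 - x) ^+ 2 + (w.2 + 2 * v) ^+ 2.
  have := sqr_ge0 (w.1 - x); nra.
have pos1 t : 0 < sqdist_circle (w.1 - x) (w.2 + 2 * v) r t.
  rewrite /sqdist_circle; have := sqr_ge0 (w.1 - x + r * cos t).
  have : 0 < w.2 + 2 * v + r * sin t by have := sin_geN1 t; nra.
  nra.
have pos2 t : 0 < sqdist_circle (w.1 - x) (w.2 - v) r t + e.
  have : 0 <= sqdist_circle (w.1 - x) (w.2 - v) r t by rewrite addr_ge0 ?sqr_ge0.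
  lra.
have c1 : continuous f1.
  move=> t. apply: (@continuous_at_ln _ _ (sqdist_circle (w.1 - x) (w.2 + 2 * v) r)) => //.
  have := @sqdist_circle_cont (w.1 - x) (w.2 + 2 * v) r 0 t.
  by under eq_fun do rewrite addr0.
have c2 : continuous f2.
  move=> t. apply: (@continuous_at_ln _ _ (fun t => sqdist_circle (w.1 - x) (w.2 - v) r t + e)) => //.
  exact: sqdist_circle_cont.
have bE t : bump x v d e (circle_point w r t) = d * (f1 t - f2 t).
  have e1 : w.1 - x + r * cos t = w.1 + r * cos t - x by ring.
  have e2 : w.2 + 2 * v + r * sin t = w.2 + r * sin t + 2 * v by ring.
  have e3 : w.2 - v + r * sin t = w.2 + r * sin t - v by ring.
  rewrite /bump /f1 /f2 -ln_div ?posrE// /sqdist_circle e1 e2 e3//.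
have cd : continuous (fun t => f1 t - f2 t).
  by move=> t; apply: continuous_atB; [exact: c1|exact: c2].
have cdd : continuous (fun t => d * (f1 t - f2 t)).
  by move=> t; apply: continuous_atM; [exact: continuous_at_cst|exact: cd].
have -> : (\int[lebesgue_measure]_(theta in circ)
    (bump x v d e (circle_point w r theta))%:E =
   (\int[lebesgue_measure]_(t in circ) (d * (f1 t - f2 t))%R)%:E)%E.
  rewrite /Rintegral fineK; first by apply: eq_integral => t _; rewrite bE.
  exact: integrable_fin_num (integrable_circle cdd).
rewrite RintegralZl//; last exact: integrable_circle.
rewrite RintegralB//; [|exact: integrable_circle|exact: integrable_circle].
rewrite -EFinM lee_fin log_circle_mean_harmonic// ler_pdivrMl ?pi2_gt0//.
rewrite /bump ln_div ?posrE; last 2 first.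
- by apply: le_lt_trans rq; exact: sqr_ge0.
- by rewrite ltr_wpDl// addr_ge0 ?sqr_ge0.
rewrite mulrCA ler_pM2l// mulrBr lerB//.
exact: log_circle_mean_subharmonic.
Qed.

Lemma bump_den_gt0 x v e z : 0 < e -> 0 < (z.1 - x) ^+ 2 + (z.2 - v) ^+ 2 + e.
Proof. by move=> e0; rewrite ltr_wpDl// addr_ge0 ?sqr_ge0. Qed.

Lemma bump_num_gt0 x v z : 0 < v -> upper_half_plane z -> 0 < (z.1 - x) ^+ 2 + (z.2 + 2 * v) ^+ 2.
Proof.
move=> v0 /upper_gt0 z0; rewrite ltr_wpDl ?sqr_ge0// exprn_gt0//; lra.
Qed.

(** Numerator minus denominator is [6 v z.2 + 3 v^2 - e]. *)
Lemma bump_gt0 x v d e z : 0 < v -> 0 < d -> 0 < e -> e <= v ^+ 2 -> upper_half_plane z -> 0 < bump x v d e z.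
Proof.
move=> v0 d0 e0 ev zu; rewrite mulr_gt0// ln_gt0// ltr_pdivlMr ?bump_den_gt0// mul1r.
have := mulr_gt0 (upper_gt0 zu) v0; have : 0 < v ^+ 2 by rewrite exprn_gt0.
lra.
Qed.

Lemma bump_cont x v d e z : 0 < v -> 0 < e -> upper_half_plane z -> {for z, continuous (bump x v d e)}.
Proof.
move=> v0 e0 zu; have c1 : {for z, continuous (fun z : R * R => (z.1 - x) ^+ 2)}.
  by apply/continuous_atX/continuous_atB; [exact: cvg_fst|exact: continuous_at_cst].
have c2 k : {for z, continuous (fun z : R * R => (z.2 + k) ^+ 2)}.
  by apply/continuous_atX/continuous_atD; [exact: cvg_snd|exact: continuous_at_cst].
rewrite /bump; apply: continuous_atM; first exact: continuous_at_cst.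
apply: continuous_at_ln; first by rewrite divr_gt0 ?bump_num_gt0 ?bump_den_gt0.
apply: continuous_atM; first exact: (continuous_atD c1 (c2 _)).
apply: continuous_atV; first by rewrite gt_eqF// bump_den_gt0.
by apply: continuous_atD (continuous_atD c1 (c2 _)) _; exact: continuous_at_cst.
Qed.

(** With [Y = z.2 - v], [(Y + 3 v)^2 <= 2 Y^2 + 18 v^2], and off the square [v^2] is at most 4 times
    the squared distance to the pole. The quotient is thus at most [2 + 18 * 4 = 74], uniformly in
    [e], and [ln 74 <= 74]. *)
Lemma bump_le_far x v d e z : 0 < v -> 0 < d -> 0 < e -> upper_half_plane z ->
  ~ (`|z.1 - x| < v / 2 /\ `|z.2 - v| < v / 2) -> bump x v d e z <= 74 * d.
Proof.
move=> v0 d0 e0 zu far; rewrite mulrC /bump ler_pM2l//.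
have h : v ^+ 2 / 4 <= (z.1 - x) ^+ 2 + (z.2 - v) ^+ 2.
  have vE : v ^+ 2 / 4 = (v / 2) ^+ 2 by field.
  have v20 : 0 <= v / 2 by rewrite divr_ge0// ltW.
  rewrite vE leNgt; apply/negP => lt; apply: far; split.
    rewrite -(@ltr_sqr _ `|_|) ?nnegrE// real_normK ?num_real//.
    by apply: le_lt_trans lt; rewrite lerDl sqr_ge0.
  rewrite -(@ltr_sqr _ `|_|) ?nnegrE// real_normK ?num_real//.
  by apply: le_lt_trans lt; rewrite lerDr sqr_ge0.
apply: (@le_trans _ _ (ln 74)); last by apply/ltW/ln_sublinear.
have n0 := @bump_num_gt0 x _ _ v0 zu; have den0 := @bump_den_gt0 x v _ z e0.
rewrite ler_ln ?posrE ?divr_gt0// ler_pdivrMr//.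
have := sqr_ge0 (z.2 - v - 3 * v); have := sqr_ge0 (z.1 - x); lra.
Qed.

(* This value of [e] gives the peak [bump (x, v) = T + 4 d]. *)
Lemma bump_le_near x v d T z : 0 < v -> 0 < d -> upper_half_plane z ->
  `|z.1 - x| < v / 2 -> `|z.2 - v| < v / 2 ->
  bump x v d (9 * v ^+ 2 * expR (- (T / d + 4))) z <= T + 5 * d.
Proof.
move=> v0 d0 zu; rewrite !ltr_norml => /andP[a1 a2] /andP[b1 b2].
set e := _ * expR _.
have e0 : 0 < e by rewrite mulr_gt0 ?expR_gt0// mulr_gt0// exprn_gt0.
have -> : T + 5 * d = d * (1 + (T / d + 4)) by field; rewrite gt_eqF.
rewrite ler_pM2l// -[leRHS]expRK expRD.
have n0 := @bump_num_gt0 x _ _ v0 zu; have den0 := @bump_den_gt0 x v _ z e0.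
rewrite ler_ln ?posrE ?divr_gt0 ?mulr_gt0 ?expR_gt0//.
rewrite ler_pdivrMr//.
have v2 : 0 < v ^+ 2 by rewrite exprn_gt0.
have e1 : 2 <= expR 1 :> R by have := expR_ge1Dx (1 : R); lra.
(* On the square the numerator is at most [18 v^2], twice its value at the pole; the factor
   [expR 1 >= 2] that comes with the fifth [d] absorbs this. *)
apply: (@le_trans _ _ (18 * v ^+ 2)).
  have : (z.1 - x) ^+ 2 <= v ^+ 2 by nra.
  have : (z.2 + 2 * v) ^+ 2 <= 16 * v ^+ 2 by move: zu => /upper_gt0; nra.
  lra.
apply: (@le_trans _ _ (expR 1 * expR (T / d + 4) * e)); last first.
  rewrite ler_pM2l ?mulr_gt0 ?expR_gt0// lerDr addr_ge0 ?sqr_ge0//.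
have -> : expR 1 * expR (T / d + 4) * e = expR 1 * (9 * v ^+ 2).
  by rewrite /e expRN; field; rewrite gt_eqF ?expR_gt0.
nra.
Qed.

Lemma bump_center x v d T : 0 < v -> 0 < d ->
  T <= bump x v d (9 * v ^+ 2 * expR (- (T / d + 4))) (x, v).
Proof.
move=> v0 d0; rewrite /bump /= !subrr expr0n/= !add0r expRN.
have -> : (v + 2 * v) ^+ 2 / (9 * v ^+ 2 * (expR (T / d + 4))^-1) = expR (T / d + 4).
  by field; rewrite !gt_eqF ?expR_gt0.
rewrite expRK mulrDr mulrCA divff ?gt_eqF// mulr1 lerDl mulr_ge0// ltW//.
Qed.

(** The purpose of the [4] in the exponent: [expR 4 >= 16 > 9], which gives the bound [e <= v ^+ 2]
    behind the positivity of the bump. *)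
Lemma bump_eps v d T : 0 < v -> 0 < d -> 0 <= T ->
  0 < 9 * v ^+ 2 * expR (- (T / d + 4)) <= v ^+ 2.
Proof.
move=> v0 d0 T0; have v2 : 0 < v ^+ 2 by rewrite exprn_gt0.
rewrite mulr_gt0 ?expR_gt0 ?mulr_gt0//=.
rewrite mulrAC -[leRHS]mul1r ler_pM2r// expRN ler_pdivrMr ?expR_gt0// mul1r.
have Td : 0 <= T / d by rewrite divr_ge0// ltW.
have e1 : 2 <= expR 1 :> R by have := expR_ge1Dx (1 : R); lra.
have e2 : 4 <= expR (1 + 1) :> R by rewrite expRD; nra.
apply: (@le_trans _ _ (expR (1 + 1 + (1 + 1)))); last by rewrite ler_expR; lra.
rewrite expRD; nra.
Qed.

End Bump.

(** * Double integrals over rectangles *)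

Section DoubleIntegral.
Context {R : realType}.
Local Notation leb := (@lebesgue_measure R).
Local Notation T2 := (measurableTypeR R * measurableTypeR R)%type.

(** The bridge from the product topology, which continuity refers to, to the product sigma-algebra,
    which Fubini's theorem refers to: an open set is a countable union of boxes with rational
    centres and radii [1 / (n + 1)]. *)
Lemma open_prod_measurable (U : set (R * R)) : open U ->
  measurable (U : set T2).
Proof.
move=> oU.
pose rad (n : nat) : R := n.+1%:R^-1.
pose box (i : rat * rat * nat) : set T2 :=
  [set x : measurableTypeR R | ball (ratr i.1.1 : R) (rad i.2) x] `*`
  [set x : measurableTypeR R | ball (ratr i.1.2 : R) (rad i.2) x].
pose F i : set T2 := if pselect (box i `<=` U) then box i else set0.
have -> : U = \bigcup_i F i.
  apply/seteqP; split => [z Uz|z [i _]]; last first.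
    by rewrite /F; case: pselect => // h /h.
  have /nbhs_ballP[e /= e0 eU] : nbhs z U by exact: open_nbhs_nbhs.
  pose n := Num.truncn (2 / e).
  have rn0 : 0 < rad n by rewrite invr_gt0.
  have rne : rad n + rad n <= e.
    have : 2 / e < n.+1%:R by exact: truncnS_gt.
    rewrite ltr_pdivrMr// => h.
    have -> : rad n + rad n = 2 / n.+1%:R by rewrite /rad; ring.
    by rewrite ler_pdivrMr// mulrC ltW.
  have rt (x : R) : exists q : rat, ball (ratr q : R) (rad n) x.
    have [|q] := @rat_in_itvoo R (x - rad n) (x + rad n).
      by rewrite ltrD2l gtrN.
    rewrite in_itv/= => /andP[q1 q2]; exists q; rewrite /ball/= ltr_norml.
    by apply/andP; split; lra.
  have [q1 hq1] := rt z.1; have [q2 hq2] := rt z.2.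
  have sub : box (q1, q2, n) `<=` U.
    move=> y [/= y1 y2]; apply: eU; split => /=.
      apply: le_ball rne _ _; apply: ball_triangle y1; exact: ball_sym.
    apply: le_ball rne _ _; apply: ball_triangle y2; exact: ball_sym.
  by exists (q1, q2, n) => //; rewrite /F; case: (pselect (box (q1, q2, n) `<=` U)).
apply: countable_bigcupT_measurable; first exact: countableP.
move=> i; rewrite /F; case: pselect => /= ?; last exact: measurable0.
by apply: measurableX; exact: measurable_ball.
Qed.

Lemma continuous_prod_measurable (f : R * R -> R) : continuous f ->
  measurable_fun [set: T2] (f : T2 -> R).
Proof.
move=> /continuousP cf; apply: (measurability _ (RGenOpens.measurableE R)).
move=> _ [B [a [b ->]] <-]; rewrite setTI.
have oab : open (f @^-1` `]a, b[) by exact/cf/interval_open.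
exact: (open_prod_measurable oab).
Qed.

Local Notation leb2 := (leb \x leb)%E.

Definition rect (a b c d : R) : set T2 := `[a, b] `*` `[c, d].

Lemma rectP (a b c d : R) (z : R * R) :
  rect a b c d z <-> (a <= z.1 <= b) /\ (c <= z.2 <= d).
Proof. by rewrite /rect /setX/= !in_itv/=. Qed.

Lemma measurable_rect a b c d : measurable (rect a b c d).
Proof. by apply: measurableX. Qed.

Definition clamp (a b x : R) : R := Num.min (Num.max x a) b.

Lemma clamp_cont a b : continuous (clamp a b).
Proof.
move=> x; apply: (@continuous_min R R (fun x => Num.max x a) (cst b)); last exact: cst_continuous.
by apply: (@continuous_max R R id (cst a)); [exact: cvg_id|exact: cst_continuous].
Qed.

Lemma clamp_in a b x : a <= b -> a <= clamp a b x <= b.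
Proof. by move=> ab; rewrite le_min ge_min lexx orbT andbT le_max lexx orbT ab. Qed.

Lemma clamp_id a b x : a <= x <= b -> clamp a b x = x.
Proof. by move=> /andP[ax xb]; rewrite /clamp max_l// min_l. Qed.

Section Rectangle.
Context (a b c d : R) (ab : a <= b) (cd : c <= d).
Local Notation Q := (rect a b c d).

(** Composition with the nearest-point retraction onto the rectangle. The functions at hand are
    known to be continuous at the points of [Q] only, whereas [continuous_prod_measurable] is about
    the whole plane. *)
Lemma continuous_rect_extend (f : R * R -> R) :
  (forall z, Q z -> {for z, continuous f}) ->
  exists2 g : R * R -> R, continuous g & forall z, Q z -> g z = f z.
Proof.
move=> cf; exists (fun z => f (clamp a b z.1, clamp c d z.2)); last first.
  by move=> [x y] /rectP[/= h1 h2]; rewrite !clamp_id.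
move=> z; apply: (@continuous_at_comp _ _ _ f (fun z : R * R => (clamp a b z.1, clamp c d z.2))).
  apply: continuous_at_pair.
    by apply: (@continuous_at_comp _ _ _ (clamp a b) fst); [exact: cvg_fst|exact: clamp_cont].
  by apply: (@continuous_at_comp _ _ _ (clamp c d) snd); [exact: cvg_snd|exact: clamp_cont].
by apply: cf; apply/rectP; split; exact: clamp_in.
Qed.

Lemma compact_rect : compact (rect a b c d : set (R * R)).
Proof. by apply: compact_setX; exact: segment_compact. Qed.

Lemma rect_measure_fin : (leb2 Q < +oo)%E.
Proof.
rewrite product_measure1E//= !lebesgue_measure_itv/=.
by do 2 case: ifP => _; rewrite ?mul0e ?mule0 ?ltry// -!EFinB -EFinM ltry.
Qed.

Lemma integrable_rect (f : R * R -> R) :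
  (forall z, Q z -> {for z, continuous f}) -> leb2.-integrable Q (EFin \o f).
Proof.
move=> /continuous_rect_extend[g cg gf].
apply: (eq_integrable (measurable_rect a b c d) (EFin \o g)).
  by move=> z /set_mem /gf /= ->.
apply: measurable_bounded_integrable; [exact: measurable_rect|exact: rect_measure_fin| |].
  apply: measurable_funTS; exact: continuous_prod_measurable.
have : compact (g @` Q).
  apply: (@continuous_compact _ _ g); last exact: compact_rect.
  exact: continuous_subspaceT.
move=> /compact_bounded[M [Mr hM]]; exists M; split => // x Mx z Qz /=.
by apply: hM => //; exists z.
Qed.

Lemma fubini_rect1 (f : R * R -> R) :
  (forall z, Q z -> {for z, continuous f}) ->
  (\int[leb2]_(z in Q) (f z)%:E =
   \int[leb]_(x in `[a, b]) \int[leb]_(y in `[c, d]) (f (x, y))%:E)%E.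
Proof.
move=> cf; rewrite integral_mkcond -integral12_prod_meas1; last first.
  by apply/integrable_restrict; [exact: measurable_rect|exact: measurableT
    |rewrite setTI; exact: integrable_rect].
rewrite [RHS]integral_mkcond; apply: eq_integral => x _.
rewrite /fubini_F patchE; case: ifPn => xab.
  rewrite [RHS]integral_mkcond; apply: eq_integral => y _.
  rewrite !patchE; have -> : ((x, y) \in Q) = (y \in `[c, d]%classic) => //.
  by apply/idP/idP => /set_mem h; apply/mem_set; [case: h|split => //; exact/set_mem].
apply: integral0_eq => y _; rewrite patchE.
by case: ifPn => // /set_mem[/= h _]; rewrite mem_set in xab.
Qed.

Lemma fubini_rect2 (f : R * R -> R) :
  (forall z, Q z -> {for z, continuous f}) ->
  (\int[leb2]_(z in Q) (f z)%:E =
   \int[leb]_(y in `[c, d]) \int[leb]_(x in `[a, b]) (f (x, y))%:E)%E.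
Proof.
move=> cf; rewrite integral_mkcond -integral21_prod_meas1; last first.
  by apply/integrable_restrict; [exact: measurable_rect|exact: measurableT
    |rewrite setTI; exact: integrable_rect].
rewrite [RHS]integral_mkcond; apply: eq_integral => y _.
rewrite /fubini_G patchE; case: ifPn => ycd.
  rewrite [RHS]integral_mkcond; apply: eq_integral => x _.
  rewrite !patchE; have -> : ((x, y) \in Q) = (x \in `[a, b]%classic) => //.
  by apply/idP/idP => /set_mem h; apply/mem_set; [case: h|split => //; exact/set_mem].
apply: integral0_eq => x _; rewrite patchE.
by case: ifPn => // /set_mem[/= _ h]; rewrite mem_set in ycd.
Qed.

Lemma measurable_fubini_rect2 (f : R * R -> R) :
  (forall z, Q z -> {for z, continuous f}) ->
  measurable_fun `[c, d] (fun y => \int[leb]_(x in `[a, b]) (f (x, y))%:E)%E.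
Proof.
move=> cf; have intf : leb2.-integrable setT ((EFin \o f) \_ Q).
  by apply/integrable_restrict; [exact: measurable_rect|exact: measurableT
    |rewrite setTI; exact: integrable_rect].
have := measurable_funS measurableT (@subsetT _ _) (measurable_fubini_G intf).
move=> /(_ `[c, d]%classic); apply: eq_measurable_fun => y ycd.
rewrite /fubini_G [RHS]integral_mkcond; apply: eq_integral => x _.
rewrite !patchE; have -> : ((x, y) \in Q) = (x \in `[a, b]%classic) => //.
by apply/idP/idP => /set_mem h; apply/mem_set; [case: h|split => //; exact/set_mem].
Qed.

End Rectangle.
End DoubleIntegral.

(** * Harmonic functions *)

Section Green.
Context {R : realType}.
Local Notation leb := (@lebesgue_measure R).
Local Notation leb2 := (leb \x leb)%E.
Implicit Types (a b c d k l x y : R) (z : R * R).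
Implicit Types (h hx hxx hy hyy p px pxx py pyy : R * R -> R).

(* [hx, hxx, hy, hyy] are the partial derivatives of [h] on [Q]. *)
Definition jet (Q : set (R * R)) h hx hxx hy hyy : Prop := forall z, Q z ->
  [/\ is_derive z.1 1 (fun x => h (x, z.2)) (hx z),
      is_derive z.1 1 (fun x => hx (x, z.2)) (hxx z),
      is_derive z.2 1 (fun y => h (z.1, y)) (hy z) &
      is_derive z.2 1 (fun y => hy (z.1, y)) (hyy z)] /\
  [/\ continuous_at z h, continuous_at z hxx & continuous_at z hyy].

Lemma slice1_cont (f : R * R -> R) x y :
  continuous_at (x, y) f -> continuous_at x (fun t => f (t, y)).
Proof.
move=> cf; apply: (@continuous_at_comp _ _ _ f (fun t => (t, y))) => //.
by apply: (@continuous_at_pair _ _ id (fun=> y)); [exact: cvg_id|exact: cst_continuous].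
Qed.

Lemma slice2_cont (f : R * R -> R) x y :
  continuous_at (x, y) f -> continuous_at y (fun t => f (x, t)).
Proof.
move=> cf; apply: (@continuous_at_comp _ _ _ f (fun t => (x, t))) => //.
by apply: (@continuous_at_pair _ _ (fun=> x) id); [exact: cst_continuous|exact: cvg_id].
Qed.

(** Green's second identity, one variable at a time: [hxx p - h pxx] is the x-derivative of
    [hx p - h px], which vanishes on the vertical sides, and likewise in [y], where the lower side
    alone contributes. Fubini's theorem is used in one order for each term. *)
Lemma green_rect a b c d h hx hxx hy hyy p px pxx py pyy : a < b -> c < d ->
  jet (rect a b c d) h hx hxx hy hyy -> jet (rect a b c d) p px pxx py pyy ->
  (forall z, rect a b c d z -> hxx z + hyy z = 0) ->
  (forall y, c <= y <= d ->
    [/\ p (a, y) = 0, p (b, y) = 0, px (a, y) = 0 & px (b, y) = 0]) ->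
  (forall x, a <= x <= b ->
    [/\ p (x, c) = 0, p (x, d) = 0 & py (x, d) = 0]) ->
  (\int[leb2]_(z in rect a b c d) (- (h z * (pxx z + pyy z)))%:E =
   \int[leb]_(x in `[a, b]) (h (x, c) * py (x, c))%:E)%E.
Proof.
move=> ab cd jh jp harm bx bdy.
have aab : a <= a <= b by rewrite lexx ltW.
have abb : a <= b <= b by rewrite lexx ltW.
have ccd : c <= c <= d by rewrite lexx ltW.
have cdd : c <= d <= d by rewrite lexx ltW.
pose f1 z := hxx z * p z - h z * pxx z.
pose f2 z := hyy z * p z - h z * pyy z.
have cf1 z : rect a b c d z -> continuous_at z f1.
  move=> Qz; have [_ [? ? ?]] := jh _ Qz; have [_ [? ? ?]] := jp _ Qz.
  by apply: continuous_atB; exact: continuous_atM.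
have cf2 z : rect a b c d z -> continuous_at z f2.
  move=> Qz; have [_ [? ? ?]] := jh _ Qz; have [_ [? ? ?]] := jp _ Qz.
  by apply: continuous_atB; exact: continuous_atM.
have I1 : (\int[leb2]_(z in rect a b c d) (f1 z)%:E = 0)%E.
  rewrite (fubini_rect2 (ltW ab) (ltW cd)) //.
  apply: integral0_eq => y /=; rewrite in_itv/= => ycd.
  apply: (etrans (@integral_derive _ (fun x => hx (x, y) * p (x, y) - h (x, y) * px (x, y))
    (fun x => f1 (x, y)) _ _ ab _ _)).
  - move=> x xab; have Qz : rect a b c d (x, y) by apply/rectP.
    have [[/= h1 h2 _ _] _] := jh _ Qz; have [[/= p1 p2 _ _] _] := jp _ Qz.
    by apply: is_derive_eq (is_derive1B (is_derive1M h2 p1) (is_derive1M h1 p2)) _; rewrite /f1; ring.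
  - move=> x xab; have Qz : rect a b c d (x, y) by apply/rectP.
    exact: (slice1_cont (cf1 _ Qz)).
  - by have [-> -> -> ->] := bx _ ycd; rewrite !mulr0 subrr.
have I2 : (\int[leb2]_(z in rect a b c d) (f2 z)%:E =
           \int[leb]_(x in `[a, b]) (h (x, c) * py (x, c))%:E)%E.
  rewrite (fubini_rect1 (ltW ab) (ltW cd)) //.
  apply: eq_integral => x /set_mem/=; rewrite in_itv/= => xab.
  apply: (etrans (@integral_derive _ (fun y => hy (x, y) * p (x, y) - h (x, y) * py (x, y))
    (fun y => f2 (x, y)) _ _ cd _ _)).
  - move=> y ycd; have Qz : rect a b c d (x, y) by apply/rectP.
    have [[/= _ _ h1 h2] _] := jh _ Qz; have [[/= _ _ p1 p2] _] := jp _ Qz.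
    by apply: is_derive_eq (is_derive1B (is_derive1M h2 p1) (is_derive1M h1 p2)) _; rewrite /f2; ring.
  - move=> y ycd; have Qz : rect a b c d (x, y) by apply/rectP.
    exact: (slice2_cont (cf2 _ Qz)).
  - by have [-> -> ->] := bdy _ xab; rewrite !mulr0 subrr !add0r opprK.
rewrite -I2 -[RHS]add0e -I1 -integralD_EFin/=; last 3 first.
- exact: measurable_rect.
- exact: (integrable_rect (ltW ab) (ltW cd)).
- exact: (integrable_rect (ltW ab) (ltW cd)).
apply: eq_integral => z /set_mem Qz; congr EFin; rewrite /f1 /f2.
have -> : hxx z = - hyy z by apply/eqP; rewrite -addr_eq0 harm.
by ring.
Qed.

(** Lets one test function, fixed on a reference rectangle, serve at every place and scale. *)
Lemma jet_affine p px pxx py pyy (x0 y0 : R) k l (Q Q' : set (R * R)) :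
  (forall z, Q z -> Q' (k * (z.1 - x0), l * (z.2 - y0))) ->
  jet Q' p px pxx py pyy ->
  jet Q (fun z => p (k * (z.1 - x0), l * (z.2 - y0)))
    (fun z => k * px (k * (z.1 - x0), l * (z.2 - y0)))
    (fun z => k ^+ 2 * pxx (k * (z.1 - x0), l * (z.2 - y0)))
    (fun z => l * py (k * (z.1 - x0), l * (z.2 - y0)))
    (fun z => l ^+ 2 * pyy (k * (z.1 - x0), l * (z.2 - y0))).
Proof.
move=> QQ' jp z Qz; have [[/= h1 h2 h3 h4] [c1 c2 c3]] := jp _ (QQ' _ Qz).
have da (m t t0 : R) : is_derive t 1 (fun t => m * (t - t0)) m.
  apply: is_derive_eq (is_derive1M (is_derive1C m t) (is_derive1B (is_derive1I t) (is_derive1C t0 t))) _; ring.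
have ca : continuous_at z (fun z => (k * (z.1 - x0), l * (z.2 - y0))).
  apply: (@continuous_at_pair _ _ (fun z => k * (z.1 - x0)) (fun z => l * (z.2 - y0))).
    by apply: continuous_atM; [exact: continuous_at_cst|apply: continuous_atB; [exact: cvg_fst|exact: continuous_at_cst]].
  by apply: continuous_atM; [exact: continuous_at_cst|apply: continuous_atB; [exact: cvg_snd|exact: continuous_at_cst]].
split; split => /=.
- apply: is_derive_eq (is_derive1_comp_fun (g := fun t => k * (t - x0)) (x := z.1) h1 (da k z.1 x0)) _; ring.
- apply: is_derive_eq (is_derive1M (is_derive1C k _) (is_derive1_comp_fun (g := fun t => k * (t - x0)) (x := z.1) h2 (da k z.1 x0))) _; ring.
- apply: is_derive_eq (is_derive1_comp_fun (g := fun t => l * (t - y0)) (x := z.2) h3 (da l z.2 y0)) _; ring.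
- apply: is_derive_eq (is_derive1M (is_derive1C l _) (is_derive1_comp_fun (g := fun t => l * (t - y0)) (x := z.2) h4 (da l z.2 y0))) _; ring.
- exact: (continuous_at_comp ca c1).
- by apply: continuous_atM; [exact: continuous_at_cst|exact: (continuous_at_comp ca c2)].
- by apply: continuous_atM; [exact: continuous_at_cst|exact: (continuous_at_comp ca c3)].
Qed.

End Green.

(** * The cut-off and the regularised logarithm, with their Laplacians *)

Section TestFunctions.
Context {R : realType}.
Local Notation leb := (@lebesgue_measure R).
Local Notation leb2 := (leb \x leb)%E.
Implicit Types (e x y u : R) (z : R * R).

(** A polynomial cut-off for [[-1, 1]]: it vanishes with its first derivative at both ends, as
    [green_rect] requires, and on the interval its second derivative is negative only where [cut]
    itself is bounded below. *)
Definition cut x : R := (1 - x ^+ 2) ^+ 3.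
Definition cut1 x : R := - (6 * x * (1 - x ^+ 2) ^+ 2).
Definition cut2 x : R := (1 - x ^+ 2) * (30 * x ^+ 2 - 6).

Lemma der_1Bsqr x : is_derive x 1 (fun t => 1 - t ^+ 2) (- (2 * x)).
Proof. apply: is_derive_eq (is_derive1B (is_derive1C 1 x) (is_derive1X 1 (is_derive1I x))) _; ring. Qed.

Lemma der_cut x : is_derive x 1 cut (cut1 x).
Proof. apply: is_derive_eq (is_derive1X 2 (der_1Bsqr x)) _; rewrite /cut1; ring. Qed.

Lemma der_cut1 x : is_derive x 1 cut1 (cut2 x).
Proof.
apply: is_derive_eq (is_derive1N (is_derive1M (is_derive1M (is_derive1C 6 x) (is_derive1I x)) (is_derive1X 1 (der_1Bsqr x)))) _.
by rewrite /cut2; ring.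
Qed.

Lemma der_cut2 x : exists d, is_derive x 1 cut2 d.
Proof.
exists (- (2 * x) * (30 * x ^+ 2 - 6) + (1 - x ^+ 2) * (60 * x)).
apply: is_derive_eq (is_derive1M (der_1Bsqr x) (is_derive1B (is_derive1M (is_derive1C 30 x) (is_derive1X 1 (is_derive1I x))) (is_derive1C 6 x))) _.
ring.
Qed.

Lemma cut_cont : continuous cut.
Proof. by move=> x; exact: is_derive1_continuous (der_cut x). Qed.
Lemma cut1_cont : continuous cut1.
Proof. by move=> x; exact: is_derive1_continuous (der_cut1 x). Qed.
Lemma cut2_cont : continuous cut2.
Proof. by move=> x; have [d h] := der_cut2 x; exact: is_derive1_continuous h. Qed.

Lemma cut_itv x : -1 <= x <= 1 -> 0 <= cut x <= 1.
Proof.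
move=> /andP[x1 x2]; have h : x ^+ 2 <= 1 by nra.
have h0 := sqr_ge0 x.
by rewrite /cut exprn_ge0 ?subr_ge0//= exprn_ile1 ?subr_ge0//; lra.
Qed.

Lemma cut_1 x : x ^+ 2 = 1 -> (cut x = 0) * (cut1 x = 0).
Proof. by move=> h; rewrite /cut /cut1 h subrr !expr0n/= mulr0 oppr0. Qed.

Section LogTest.
Context (e : R) (e0 : 0 < e).

Definition sq_den z : R := z.1 ^+ 2 + z.2 ^+ 2 + e.
(* The Laplacian of [ln 3 - ln (x^2 + y^2 + e)] is [- 4 e / (x^2 + y^2 + e) ^ 2], an
   approximate Dirac mass; the terms brought in by the cut-off are bounded above
   independently of [e], by [log_test_lap]. *)
Definition log_test z : R := cut z.1 * cut z.2 * (ln 3 - ln (sq_den z)).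
Definition log_test1 z : R :=
  cut z.2 * (cut1 z.1 * (ln 3 - ln (sq_den z)) - cut z.1 * (2 * z.1 / sq_den z)).
Definition log_test2 z : R :=
  cut z.2 * (cut2 z.1 * (ln 3 - ln (sq_den z)) - 4 * z.1 * cut1 z.1 / sq_den z
    + cut z.1 * (4 * z.1 ^+ 2 / sq_den z ^+ 2 - 2 / sq_den z)).
Definition swap z : R * R := (z.2, z.1).

Lemma sq_den_gt0 z : 0 < sq_den z.
Proof. by rewrite ltr_wpDl// addr_ge0 ?sqr_ge0. Qed.

Lemma sq_den_cont : continuous sq_den.
Proof.
move=> z; apply: continuous_atD; last exact: continuous_at_cst.
by apply: continuous_atD; apply: continuous_atX; [exact: cvg_fst|exact: cvg_snd].
Qed.

Lemma der_sq_den z : is_derive z.1 1 (fun x => sq_den (x, z.2)) (2 * z.1).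
Proof.
apply: is_derive_eq (is_derive1D (is_derive1D (is_derive1X 1 (is_derive1I z.1)) (is_derive1C (z.2 ^+ 2) z.1)) (is_derive1C e z.1)) _.
ring.
Qed.

Lemma der_log_sq_den z :
  is_derive z.1 1 (fun x => ln 3 - ln (sq_den (x, z.2))) (- (2 * z.1 / sq_den z)).
Proof.
have h : 0 < sq_den (z.1, z.2) := sq_den_gt0 _.
apply: is_derive_eq (is_derive1B (is_derive1C (ln 3) z.1)
  (is_derive1_ln_comp (f := fun x => sq_den (x, z.2)) h (der_sq_den z))) _.
by rewrite add0r; case: z {h}.
Qed.

Lemma der_inv_sq_den z :
  is_derive z.1 1 (fun x => 2 * x / sq_den (x, z.2))
    (2 / sq_den z - 4 * z.1 ^+ 2 / sq_den z ^+ 2).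
Proof.
have h : sq_den (z.1, z.2) != 0 by rewrite gt_eqF ?sq_den_gt0.
have D : is_derive z.1 1 (fun x => (sq_den (x, z.2))^-1)
    (- (2 * z.1) / sq_den z ^+ 2).
  have [d1 d2] := der_sq_den z.
  apply: DeriveDef; first exact: derivableV.
  by rewrite deriveV// d2 /GRing.scale/=; case: z {h d1 d2} => x y/=; rewrite mulrC mulNr mulrN.
apply: is_derive_eq (is_derive1M (is_derive1M (is_derive1C 2 z.1) (is_derive1I z.1)) D) _.
move: h; case: z {D} => x y /= h; move: (sq_den (x, y)) h => t t0.
by field.
Qed.

Lemma log_test_slice z :
  is_derive z.1 1 (fun x => log_test (x, z.2)) (log_test1 z) /\
  is_derive z.1 1 (fun x => log_test1 (x, z.2)) (log_test2 z).
Proof.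
have dL := der_log_sq_den z; have dI := der_inv_sq_den z.
have dc := der_cut z.1; have dc1 := der_cut1 z.1; have d2 := is_derive1C (cut z.2) z.1.
split.
  apply: is_derive_eq (is_derive1M (is_derive1M dc d2) dL) _.
  by rewrite /log_test1; case: z {dL dI dc dc1 d2} => x y/=; ring.
apply: is_derive_eq (is_derive1M d2 (is_derive1B (is_derive1M dc1 dL) (is_derive1M dc dI))) _.
rewrite /log_test2; case: z {dL dI dc dc1 d2} => x y/=; ring.
Qed.

Lemma log_test2_cont : continuous log_test2.
Proof.
move=> z; have c1 : continuous_at z (fun z : R * R => z.1) by exact: cvg_fst.
have c2 : continuous_at z (fun z : R * R => z.2) by exact: cvg_snd.
have cD := @sq_den_cont z; have D0 := sq_den_gt0 z.
have cV : continuous_at z (fun z => (sq_den z)^-1) by apply: continuous_atV; rewrite ?gt_eqF.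
have cV2 : continuous_at z (fun z => (sq_den z ^+ 2)^-1).
  by apply: continuous_atV; [rewrite gt_eqF// exprn_gt0|exact: continuous_atX].
have cL : continuous_at z (fun z => ln 3 - ln (sq_den z)).
  by apply: continuous_atB; [exact: continuous_at_cst|exact: continuous_at_ln].
have c0 : continuous_at z (fun z => cut z.1) by apply: (continuous_at_comp c1); exact: cut_cont.
have c01 : continuous_at z (fun z => cut1 z.1) by apply: (continuous_at_comp c1); exact: cut1_cont.
have c02 : continuous_at z (fun z => cut2 z.1) by apply: (continuous_at_comp c1); exact: cut2_cont.
apply: continuous_atM; first by apply: (continuous_at_comp c2); exact: cut_cont.
apply: continuous_atD.
  apply: continuous_atB; first exact: continuous_atM.
  by apply: continuous_atM => //; apply: continuous_atM => //; apply: continuous_atM => //; exact: continuous_at_cst.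
apply: continuous_atM => //; apply: continuous_atB; apply: continuous_atM => //; last exact: continuous_at_cst.
by apply: continuous_atM; [exact: continuous_at_cst|exact: continuous_atX].
Qed.

Lemma log_test_cont : continuous log_test.
Proof.
move=> z; have c1 : continuous_at z (fun z : R * R => z.1) by exact: cvg_fst.
have c2 : continuous_at z (fun z : R * R => z.2) by exact: cvg_snd.
have cD := @sq_den_cont z; have D0 := sq_den_gt0 z.
apply: continuous_atM; first apply: continuous_atM.
- by apply: (continuous_at_comp c1); exact: cut_cont.
- by apply: (continuous_at_comp c2); exact: cut_cont.
- by apply: continuous_atB; [exact: continuous_at_cst|exact: continuous_at_ln].
Qed.

(** By symmetry of [log_test], the derivatives in the second variable are those in the first taken
    at the swapped point. *)
Lemma log_test_jet (Q : set (R * R)) :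
  jet Q log_test log_test1 log_test2 (log_test1 \o swap) (log_test2 \o swap).
Proof.
move=> z _; have sE x y : sq_den (x, y) = sq_den (y, x) by rewrite /sq_den/= [x ^+ 2 + _]addrC.
have tE x y : log_test (x, y) = log_test (y, x).
  by rewrite /log_test sE/= [cut x * _]mulrC.
have tS : (fun y => log_test (z.1, y)) = (fun y => log_test (y, z.1)).
  by apply/funext => y; rewrite tE.
have [h1 h2] := log_test_slice z; have [h3 h4] := log_test_slice (swap z).
split; split.
- exact: h1.
- exact: h2.
- rewrite tS; exact: h3.
- exact: h4.
- exact: log_test_cont.
- exact: log_test2_cont.
- apply: (@continuous_at_comp _ _ _ log_test2 swap); last exact: log_test2_cont.
  by apply: (@continuous_at_pair _ _ snd fst); [exact: cvg_snd|exact: cvg_fst].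
Qed.

(** Write [D] for [sq_den z] and [L = ln 3 - ln D]. Adding back the Dirac term leaves the terms
    where the cut-off is differentiated. Since [D <= 3], [0 <= L <= 3 / D]; each second derivative
    of [cut] has a negative part of the right sign and a positive part with a factor [x^2] or [y^2],
    both at most [D], so it costs at most [30 * 3]. The cross terms cost [24 (x^2 + y^2) / D <= 24].
    In all [90 + 90 + 24 = 204]. *)
Lemma log_test_lap z : e <= 1 -> -1 <= z.1 <= 1 -> -1 <= z.2 <= 1 ->
  log_test2 z + log_test2 (swap z) + 4 * e / sq_den z ^+ 2 * (cut z.1 * cut z.2)
  <= 204.
Proof.
case: z => x y /= e1 xb yb; have /andP[a0 a1] := cut_itv xb; have /andP[b0 b1] := cut_itv yb.
have D0 := sq_den_gt0 (x, y); have ep := e0.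
have sE : sq_den (swap (x, y)) = sq_den (x, y) by rewrite /sq_den/= [x ^+ 2 + _]addrC.
have x2 : 0 <= x ^+ 2 <= 1 by rewrite sqr_ge0/=; case/andP: xb => *; nra.
have y2 : 0 <= y ^+ 2 <= 1 by rewrite sqr_ge0/=; case/andP: yb => *; nra.
pose L := ln 3 - ln (sq_den (x, y)).
have LE : L = ln (3 / sq_den (x, y)) by rewrite ln_div ?posrE.
have D3 : sq_den (x, y) <= 3 by rewrite /sq_den/=; case/andP: x2 => *; case/andP: y2 => *; lra.
have L0 : 0 <= L by rewrite LE ln_ge0// ler_pdivlMr// mul1r.
have L3 : L <= 3 / sq_den (x, y) by rewrite LE; apply/ltW/ln_sublinear; rewrite divr_gt0.
have xL t : 0 <= t <= sq_den (x, y) -> t * L <= 3.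
  move=> /andP[t0 tD]; apply: (@le_trans _ _ (t * (3 / sq_den (x, y)))); first exact: ler_wpM2l.
  by rewrite mulrA ler_pdivrMr// mulrC ler_pM2l.
have xL3 : x ^+ 2 * L <= 3.
  by apply: xL; rewrite /sq_den/=; case/andP: x2 => *; case/andP: y2 => *; lra.
have yL3 : y ^+ 2 * L <= 3.
  by apply: xL; rewrite /sq_den/=; case/andP: x2 => *; case/andP: y2 => *; lra.
have -> : log_test2 (x, y) + log_test2 (swap (x, y)) +
    4 * e / sq_den (x, y) ^+ 2 * (cut x * cut y) =
  (cut2 x * cut y + cut2 y * cut x) * L +
  24 * ((x ^+ 2 * (1 - x ^+ 2) ^+ 2 * cut y + y ^+ 2 * (1 - y ^+ 2) ^+ 2 * cut x) /
    sq_den (x, y)).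
  have eE : e = sq_den (x, y) - x ^+ 2 - y ^+ 2 by rewrite /sq_den/=; ring.
  rewrite {1}eE /log_test2 sE /= -/L /cut1.
  move: L {LE L0 L3 xL xL3 yL3 eE} => l; clear D3 sE.
  move: (sq_den _) D0 (cut x) a0 a1 (cut y) b0 b1 (cut2 x) (cut2 y) => D D0 a _ _ b _ _ a2 b2.
  by field; rewrite gt_eqF.
have half (s t l : R) : 0 <= s <= 1 -> 0 <= cut t <= 1 -> 0 <= l -> s * l <= 3 ->
    (1 - s) * (30 * s - 6) * cut t * l <= 90.
  move=> /andP[s0 s1] /andP[t0 t1] l0 sl.
  have k : (1 - s) * cut t <= 1 by nra.
  have k0 : 0 <= (1 - s) * cut t by apply: mulr_ge0 => //; rewrite subr_ge0.
  have -> : (1 - s) * (30 * s - 6) * cut t * l =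
    (1 - s) * cut t * (30 * (s * l)) - 6 * ((1 - s) * cut t * l) by ring.
  have : 0 <= s * l by exact: mulr_ge0.
  have : 0 <= (1 - s) * cut t * l by exact: mulr_ge0.
  by move: (s * l) sl ((1 - s) * cut t * l) => w ww v vv w0; nra.
have H1 : (cut2 x * cut y + cut2 y * cut x) * L <= 180.
  have h1 := @half _ y _ x2 (cut_itv yb) L0 xL3.
  have h2 := @half _ x _ y2 (cut_itv xb) L0 yL3.
  by rewrite /cut2 mulrDl; lra.
have H2 : (x ^+ 2 * (1 - x ^+ 2) ^+ 2 * cut y + y ^+ 2 * (1 - y ^+ 2) ^+ 2 * cut x) /
    sq_den (x, y) <= 1.
  rewrite ler_pdivrMr// mul1r.
  have third (s t : R) : 0 <= s <= 1 -> 0 <= t <= 1 -> s * (1 - s) ^+ 2 * t <= s.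
    move=> /andP[s0 s1] /andP[t0 t1]; rewrite -mulrA ler_piMr//.
    by rewrite mulr_ile1 ?sqr_ge0// exprn_ile1 ?subr_ge0//; lra.
  have t1 := third _ _ x2 (cut_itv yb); have t2 := third _ _ y2 (cut_itv xb).
  by rewrite /sq_den/=; lra.
by lra.
Qed.

End LogTest.
End TestFunctions.

(** * From directional derivatives on the half-plane to jets *)

Section HarmonicJet.
Context {R : realType}.
Implicit Types (x y : R) (z w : R * R) (h hx hy : R * R -> R).
Local Notation U := (@upper_half_plane R).

Lemma is_derive_slice1 h z : derivable h z ((1, 0) : R * R) ->
  is_derive z.1 1 (fun x => h (x, z.2)) (dx h z).
Proof.
move=> dh; have E : (fun t : R => t^-1 *: ((h \o shift z) (t *: ((1, 0) : R * R)) - h z)) =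
    (fun t : R => t^-1 *: (((fun x => h (x, z.2)) \o shift z.1) (t *: (1 : R)) - (fun x => h (x, z.2)) z.1)).
  apply/funext => t /=; congr (_ *: (h _ - _)).
    transitivity ((t * 1 + z.1, t * 0 + z.2) : R * R); first by [].
    by rewrite mulr0 add0r.
  by case: z {dh}.
by split; [rewrite /derivable -E|rewrite /dx /derive E].
Qed.

Lemma is_derive_slice2 h z : derivable h z ((0, 1) : R * R) ->
  is_derive z.2 1 (fun y => h (z.1, y)) (dy h z).
Proof.
move=> dh; have E : (fun t : R => t^-1 *: ((h \o shift z) (t *: ((0, 1) : R * R)) - h z)) =
    (fun t : R => t^-1 *: (((fun y => h (z.1, y)) \o shift z.2) (t *: (1 : R)) - (fun y => h (z.1, y)) z.2)).
  apply/funext => t /=; congr (_ *: (h _ - _)).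
    transitivity ((t * 0 + z.1, t * 1 + z.2) : R * R); first by [].
    by rewrite mulr0 add0r.
  by case: z {dh}.
by split; [rewrite /derivable -E|rewrite /dy /derive E].
Qed.

Lemma lipschitz_of_derive (f df : R -> R) x y M (r : R) :
  (forall t, `|t - x| < r -> is_derive t 1 f (df t) /\ `|df t| <= M) ->
  `|y - x| < r -> `|f y - f x| <= M * `|y - x|.
Proof.
move=> dfM yr.
have aux a b : a <= b -> (forall t, a <= t <= b -> `|t - x| < r) ->
    `|f b - f a| <= M * (b - a).
  move=> ab abr; have [||c] := @MVT_segment R f df a b ab.
  - move=> t; rewrite in_itv/= => /andP[t1 t2].
    by apply: (dfM t _).1; apply: abr; rewrite !ltW.
  - apply: derivable_within_continuous => t; rewrite in_itv/= => tab.
    by have [[] ] := dfM t (abr t tab).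
  - rewrite in_itv/= => cab ->; rewrite normrM [`|b - a|]ger0_norm ?subr_ge0//.
    by rewrite ler_wpM2r ?subr_ge0//; exact: (dfM c (abr c cab)).2.
have [xy|yx] := leP x y.
  rewrite [`|y - x|]ger0_norm ?subr_ge0//; apply: aux => // t /andP[t1 t2].
  rewrite ger0_norm ?subr_ge0//; apply: le_lt_trans yr.
  by rewrite ger0_norm ?subr_ge0// lerD2r.
have xy0 : 0 <= x - y by rewrite subr_ge0 ltW.
rewrite (distrC (f y)) (distrC y) (ger0_norm xy0).
apply: aux; first exact: ltW.
move=> t /andP[t1 t2]; rewrite (distrC t) ger0_norm ?subr_ge0//.
by apply: le_lt_trans yr; rewrite (distrC y) (ger0_norm xy0) lerD2l lerN2.
Qed.

Lemma bounded_nbhs h z : continuous_at z h ->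
  \forall w \near z, `|h w| <= `|h z| + 1.
Proof.
move=> /cvgrPdist_le /(_ 1 ltr01); apply: filterS => w hw; rewrite -[h w](subrK (h z)) addrC.
by apply: le_trans (ler_normD _ _) _; rewrite lerD2l distrC.
Qed.

Lemma open_upper : open U.
Proof.
have -> : U = snd @^-1` [set y : R | 0 < y] by [].
by apply: open_comp => [z _|]; [exact: cvg_snd|exact: open_gt].
Qed.

(** [C1_on] speaks of the partial derivatives only. They are bounded near [z], so [h] is Lipschitz
    along a vertical and then a horizontal segment; the ball of the sup norm contains the corner
    between them. *)
Lemma C1_on_continuous h z : C1_on U h -> U z -> continuous_at z h.
Proof.
move=> ch zU.
have [_ _ cx cy] := ch _ zU.
pose M := Num.max (`|dx h z| + 1) (`|dy h z| + 1).
have M0 : 0 < M by rewrite lt_max ltr_wpDl.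
have : \forall w \near z, [/\ U w, `|dx h w| <= M & `|dy h w| <= M].
  near=> w; split.
  - by near: w; exact: (open_nbhs_nbhs (conj open_upper zU)).
  - by rewrite le_max; apply/orP; left; near: w; exact: bounded_nbhs.
  - by rewrite le_max; apply/orP; right; near: w; exact: bounded_nbhs.
move=> /nbhs_ballP[r /= r0 hr].
have bd w : ball z r w -> `|h w - h z| <= M * (`|w.1 - z.1| + `|w.2 - z.2|).
  move=> [/= b1' b2'].
  have b1 : `|w.1 - z.1| < r by rewrite distrC; exact: b1'.
  have b2 : `|w.2 - z.2| < r by rewrite distrC; exact: b2'.
  have -> : h w - h z = (h w - h (z.1, w.2)) + (h (z.1, w.2) - h z) by ring.
  rewrite mulrDr; apply: le_trans (ler_normD _ _) _; apply: lerD.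
    have := @lipschitz_of_derive (fun x => h (x, w.2)) (fun x => dx h (x, w.2)) z.1 w.1 M r.
    rewrite -surjective_pairing; apply => // t tr.
    have : ball z r (t, w.2) by split => //=; rewrite /ball/= distrC.
    move=> /hr[tU t1 t2]; split => //.
    by have [d1 _ _ _] := ch _ tU; exact: (is_derive_slice1 d1).
  have := @lipschitz_of_derive (fun y => h (z.1, y)) (fun y => dy h (z.1, y)) z.2 w.2 M r.
  have -> : h z = h (z.1, z.2) by case: z {zU cx cy M M0 hr b1' b2' b1 b2}.
  apply => // t tr.
  have : ball z r (z.1, t) by split => /=; [exact: ballxx|rewrite /ball/= distrC].
  move=> /hr[tU t1 t2]; split => //.
  by have [_ d2 _ _] := ch _ tU; exact: (is_derive_slice2 d2).
apply/cvgrPdist_lt => e e0.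
have e2 : 0 < e / (2 * M) by rewrite divr_gt0// mulr_gt0.
have N1 : nbhs z (ball z r) by exact: (@nbhsx_ballx R (R * R)%type).
have N2 : nbhs z (ball z (e / (2 * M))) by exact: (@nbhsx_ballx R (R * R)%type).
near=> w.
have wr : ball z r w by near: w; exact: N1.
have we : ball z (e / (2 * M)) w by near: w; exact: N2.
rewrite distrC; apply: le_lt_trans (bd _ wr) _.
case: we => /= b1' b2'.
have b1 : `|w.1 - z.1| < e / (2 * M) by rewrite distrC; exact: b1'.
have b2 : `|w.2 - z.2| < e / (2 * M) by rewrite distrC; exact: b2'.
have : `|w.1 - z.1| + `|w.2 - z.2| < e / M.
  have -> : e / M = e / (2 * M) + e / (2 * M) by field; rewrite gt_eqF.
  exact: ltrD.
by rewrite ltr_pdivlMr// mulrC.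
Unshelve. all: by end_near. Qed.

Lemma harmonic_jet h : harmonic_on U h ->
  jet U h (dx h) (dx (dx h)) (dy h) (dy (dy h)).
Proof.
move=> [[c1 cx cy] _] z zU.
have [a1 a2 _ _] := c1 _ zU; have [b1 _ b3 _] := cx _ zU.
have [_ d2 _ d4] := cy _ zU.
split; split.
- exact: is_derive_slice1.
- exact: is_derive_slice1.
- exact: is_derive_slice2.
- exact: is_derive_slice2.
- exact: C1_on_continuous.
- exact: b3.
- exact: d4.
Qed.

End HarmonicJet.

(** * The sub-mean value inequality on squares *)

Section HarmonicBounds.
Context {R : realType}.
Local Notation leb := (@lebesgue_measure R).
Local Notation leb2 := (leb \x leb)%E.
Local Notation U := (@upper_half_plane R).
Implicit Types (x y : R) (z w : R * R).

Lemma leb2_rect (a b c d : R) : a <= b -> c <= d ->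
  leb2 (rect a b c d) = ((b - a) * (d - c))%:E.
Proof.
move=> ab cd; rewrite product_measure1E//= !lebesgue_measure_itv/= !lte_fin.
move: ab cd; rewrite !le_eqVlt => /predU1P[<-|ab] /predU1P[<-|cd].
- by rewrite !ltxx mul0e subrr mul0r.
- by rewrite !ltxx mul0e subrr mul0r.
- by rewrite !ltxx mule0 subrr mulr0.
- by rewrite ab cd EFinM !EFinB.
Qed.

Lemma jet_sub (Q Q' : set (R * R)) h hx hxx hy hyy : Q `<=` Q' ->
  jet Q' h hx hxx hy hyy -> jet Q h hx hxx hy hyy.
Proof. by move=> QQ' j z /QQ'; exact: j. Qed.

(** The approximate Dirac mass with [e = d^2] seen at its own scale: there [sq_den] is at most [3 e]
    and each cut-off at least [(3 / 4)^3], so the product is at least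
    [4 / (9 e) * (1 / 6) >= 1 / (16 e)]. *)
Lemma log_test_peak (d : R) z : 0 < d -> d <= 1 / 2 ->
  z.1 ^+ 2 <= d ^+ 2 -> z.2 ^+ 2 <= d ^+ 2 ->
  1 / (16 * d ^+ 2) <=
  4 * d ^+ 2 / sq_den (d ^+ 2) z ^+ 2 * (cut z.1 * cut z.2).
Proof.
move=> d0 d12; have e4 : d ^+ 2 <= 1 / 4 by nra.
have : 0 < d ^+ 2 by rewrite exprn_gt0.
move: (d ^+ 2) e4 => e e4 e0 u1 u2.
have D0 := sq_den_gt0 e0 z.
have D3 : sq_den e z <= 3 * e by rewrite /sq_den; lra.
have cutb t : t ^+ 2 <= e -> 27 / 64 <= cut t.
  move=> te; rewrite /cut; have : 3 / 4 <= 1 - t ^+ 2 by lra.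
  move: (1 - t ^+ 2) => q q34; have : 9 / 16 <= q ^+ 2 by nra.
  by rewrite exprS; nra.
have cc : 1 / 6 <= cut z.1 * cut z.2.
  by have := cutb _ u1; have := cutb _ u2; nra.
have K2 : 4 / (9 * e) <= 4 * e / sq_den e z ^+ 2.
  rewrite ler_pdivlMr ?exprn_gt0// mulrAC ler_pdivrMr ?mulr_gt0//.
  have : sq_den e z ^+ 2 <= 9 * e ^+ 2 by nra.
  lra.
apply: (@le_trans _ _ (4 / (9 * e) * (1 / 6))); last first.
  by apply: ler_pM => //; rewrite divr_ge0// mulr_ge0// ltW.
have -> : 1 / (16 * e) = (1 / 16) * e^-1 by field; rewrite gt_eqF.
have -> : 4 / (9 * e) * (1 / 6) = (2 / 27) * e^-1 by field; rewrite gt_eqF.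
by rewrite ler_pM2r ?invr_gt0//; lra.
Qed.

Section Harmonic.
Context (h : R * R -> R) (hharm : harmonic_on U h).
Hypothesis h0 : forall z, U z -> 0 < h z.

Lemma harmonic_cont z : U z -> continuous_at z h.
Proof. by move=> /(harmonic_jet hharm)[_ []]. Qed.

Lemma rect_upper a b c d : 0 < c -> rect a b c d `<=` U.
Proof. by move=> c0 z /rectP[_ /andP[cz _]]; exact: lt_le_trans cz. Qed.

(** Green's identity with [log_test] rescaled to the square. The Dirac term yields at least
    [h w / 8] and the remaining terms cost at most [204 / l^2] times the integral of [h], whence
    [1632 = 8 * 204]. *)
Lemma sub_mean w l : 0 < l -> l < w.2 ->
  l ^+ 2 * h w <= 1632 *
    \int[leb2]_(z in rect (w.1 - l) (w.1 + l) (w.2 - l) (w.2 + l)) h z.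
Proof.
move=> l0 lw; set Q := rect _ _ _ _.
have hh := hharm; have hpos := h0.
have ab : w.1 - l < w.1 + l by lra.
have cd : w.2 - l < w.2 + l by lra.
have QU : Q `<=` U by apply: rect_upper; rewrite subr_gt0.
have wU : U w by apply: lt_trans lw.
have hw0 := hpos _ wU.
have [r r0 hr] : exists2 r : R, 0 < r & forall z, `|z.1 - w.1| < r -> `|z.2 - w.2| < r -> h w / 2 <= h z.
  have /cvgrPdist_le /(_ (h w / 2)) := harmonic_cont wU.
  rewrite divr_gt0// => /(_ isT) /nbhs_ballP[r /= r0 hr]; exists r => // z z1 z2.
  have : ball w r z by split; rewrite /ball/= distrC.
  by move=> /hr /=; rewrite ler_norml => /andP[_]; lra.
(* Instead of letting [e] tend to 0, [d] is fixed so small that [h >= h w / 2] on the square [S] of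
   half-side [d * l], where the Dirac mass sits. *)
pose d := Num.min (1 / 2) (r / (2 * l)).
have d0 : 0 < d by rewrite lt_min !divr_gt0// mulr_gt0.
have d12 : d <= 1 / 2 by rewrite ge_min lexx.
have dlr : d * l < r.
  have : d <= r / (2 * l) by rewrite ge_min lexx orbT.
  rewrite ler_pdivlMr ?mulr_gt0//; lra.
pose e := d ^+ 2.
have e0 : 0 < e by rewrite exprn_gt0.
have e1 : e <= 1 by rewrite /e; nra.
pose k := l^-1.
have k0 : 0 < k by rewrite invr_gt0.
have kl : k * l = 1 by rewrite mulVf// gt_eqF.
pose T z : R * R := (k * (z.1 - w.1), k * (z.2 - w.2)).
have TQ z : Q z -> (-1 <= (T z).1 <= 1) /\ (-1 <= (T z).2 <= 1).
  move=> /rectP[/andP[z1 z2] /andP[z3 z4]]; rewrite /T/=; clear -kl k0 z1 z2 z3 z4.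
  by split; apply/andP; split; nra.
have jp := @jet_affine _ _ _ _ _ _ w.1 w.2 k k Q setT (fun _ _ => I) (log_test_jet e0 (Q := setT)).
have jh := jet_sub QU (harmonic_jet hh).
pose lap z := k ^+ 2 * log_test2 e (T z) + k ^+ 2 * (log_test2 e \o swap) (T z).
have ctop y : y ^+ 2 = 1 -> forall x, log_test1 e (y, x) = 0.
  by move=> y1 x; rewrite /log_test1/= (cut_1 y1).1 (cut_1 y1).2 !mul0r subrr mulr0.
have ctop0 y : y ^+ 2 = 1 -> forall x, log_test e (y, x) = 0 /\ log_test e (x, y) = 0.
  by move=> y1 x; rewrite /log_test/= (cut_1 y1).1 mulr0 !mul0r.
have ea : k * (w.1 - l - w.1) = -1 by rewrite -kl; ring.
have eb : k * (w.1 + l - w.1) = 1 by rewrite -kl; ring.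
have ec : k * (w.2 - l - w.2) = -1 by rewrite -kl; ring.
have ed : k * (w.2 + l - w.2) = 1 by rewrite -kl; ring.
have s1 : (1 : R) ^+ 2 = 1 by rewrite expr1n.
have s2 : (-1 : R) ^+ 2 = 1 by rewrite sqrrN expr1n.
(* The normal derivative of the test function vanishes on the lower side too, so no boundary term
   survives. *)
have G : (\int[leb2]_(z in Q) (- (h z * lap z))%:E = 0)%E.
  rewrite (green_rect ab cd jh jp).
  - apply: integral0_eq => x _ /=; rewrite ec.
    by rewrite /swap/= ctop// !mulr0.
  - by move=> z /QU; exact: hh.2.
  - move=> y _ /=; rewrite ea eb; split; rewrite ?(ctop0 _ s1 _).1 ?(ctop0 _ s2 _).1 ?ctop ?mulr0//.
  - move=> x _ /=; rewrite ec ed /swap/=; split; rewrite ?(ctop0 _ s1 _).2 ?(ctop0 _ s2 _).2 ?ctop ?mulr0//.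
pose S := rect (w.1 - d * l) (w.1 + d * l) (w.2 - d * l) (w.2 + d * l).
have SQ : S `<=` Q.
  move=> z /rectP[/andP[z1 z2] /andP[z3 z4]]; apply/rectP.
  have dl : d * l <= l by nra.
  by clear -z1 z2 z3 z4 dl; split; apply/andP; split; lra.
(* The product of [h w / 2], the scaling factor [k^2] and the bound [1 / (16 e)] of [log_test_peak].
   The area of [S] is [4 e l^2], so [c] integrates to [h w / 8] over [S]. *)
pose c := h w * k ^+ 2 / (32 * e).
have c0 : 0 < c by rewrite divr_gt0 ?mulr_gt0// exprn_gt0.
have ptw z : Q z -> c * \1_S z - 204 * k ^+ 2 * h z <= - (h z * lap z).
  move=> Qz; have [t1 t2] := TQ _ Qz; have hz := hpos _ (QU _ Qz).
  have := log_test_lap e0 e1 t1 t2.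
  set K := 4 * e / _ * _ => L.
  have kk : 0 < k ^+ 2 by rewrite exprn_gt0.
  have hk : 0 < h z * k ^+ 2 by rewrite mulr_gt0.
  have P1 : h z * k ^+ 2 * (log_test2 e (T z) + log_test2 e (swap (T z)) + K)
     <= h z * k ^+ 2 * 204 by rewrite ler_pM2l.
  have P2 : c * \1_S z <= h z * k ^+ 2 * K.
    have D0 : 0 < sq_den e (T z) by exact: sq_den_gt0.
    have /andP[a0 a1] := cut_itv t1; have /andP[b0 b1] := cut_itv t2.
    rewrite indicE; case: (boolP (z \in S)) => [/set_mem Sz|_]; last first.
      have K0 : 0 <= K by apply: mulr_ge0; [rewrite divr_ge0 ?sqr_ge0// mulr_ge0// ltW|exact: mulr_ge0].
      by rewrite mulr0; apply: mulr_ge0 K0; exact: ltW.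
    rewrite mulr1.
    move: Sz => /rectP[/andP[z1 z2] /andP[z3 z4]].
    have hz2 : h w / 2 <= h z.
      by apply: hr; clear -z1 z2 z3 z4 dlr; rewrite ltr_norml; apply/andP; split; lra.
    have Td (t t0 : R) : t0 - d * l <= t -> t <= t0 + d * l -> (k * (t - t0)) ^+ 2 <= e.
      clear -k0 kl d0 => q1 q2; have : -d <= k * (t - t0) <= d by apply/andP; split; nra.
      by case/andP => *; rewrite /e; nra.
    have u1 : (T z).1 ^+ 2 <= e := Td _ _ z1 z2.
    have u2 : (T z).2 ^+ 2 <= e := Td _ _ z3 z4.
    have K1 := log_test_peak d0 d12 u1 u2.
    have -> : c = h w / 2 * k ^+ 2 * (1 / (16 * e)) by rewrite /c; field; rewrite gt_eqF.
    apply: ler_pM => //.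
    - by rewrite mulr_ge0// ?divr_ge0 ?(ltW hw0)// ltW.
    - by rewrite divr_ge0// mulr_ge0// ltW.
    - by rewrite ler_pM2r.
  by move: P1 P2; rewrite /lap/= /swap/=; clear; lra.
have mS : measurable S by exact: measurable_rect.
have ih : leb2.-integrable Q (EFin \o h).
  apply: (integrable_rect (ltW ab) (ltW cd)) => z /QU; exact: harmonic_cont.
have iS : leb2.-integrable Q (EFin \o \1_S).
  apply: measurable_bounded_integrable; [exact: measurable_rect|exact: rect_measure_fin| |].
    exact: measurable_indic.
  exists 1; split => // x x1 z _ /=; rewrite indicE ger0_norm// (le_trans _ (ltW x1))//.
  by case: (z \in S).
have iL : leb2.-integrable Q (EFin \o (fun z => - (h z * lap z))).
  apply: (integrable_rect (ltW ab) (ltW cd)) => z Qz.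
  apply: continuous_atN; apply: continuous_atM; first exact: (harmonic_cont (QU _ Qz)).
  by have [_ [_ p1 p2]] := jp _ Qz; exact: continuous_atD.
have mQ : measurable Q by exact: measurable_rect.
have icS : leb2.-integrable Q (EFin \o (fun z => c * \1_S z)).
  exact: (@integrableZl _ _ _ _ _ _ c _ iS).
have ich : leb2.-integrable Q (EFin \o (fun z => 204 * k ^+ 2 * h z)).
  exact: (@integrableZl _ _ _ _ _ _ (204 * k ^+ 2) _ ih).
have := @le_Rintegral _ _ _ leb2 Q _ _ mQ _ iL ptw.
move=> /(_ _)/wrap[|].
  exact: (@integrableB _ _ _ _ _ _ _ _ icS ich).
rewrite RintegralB// RintegralZl// RintegralZl//.
have -> : \int[leb2]_(z in Q) (- (h z * lap z)) = 0 by rewrite /Rintegral G.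
have -> : \int[leb2]_(z in Q) \1_S z = (2 * (d * l)) ^+ 2.
  rewrite /Rintegral integral_indic// setIidl// [X in fine X]leb2_rect; [|nra|nra].
  by rewrite /=; ring.
move: (Rintegral _ _ _) => I0.
have -> : c * (2 * (d * l)) ^+ 2 = h w / 8 * (k * l) ^+ 2.
  by rewrite /c /e; field; rewrite gt_eqF.
rewrite kl expr1n mulr1 => H.
have : l ^+ 2 * (h w / 8 - 204 * k ^+ 2 * I0) <= 0.
  by rewrite pmulr_rle0// exprn_gt0.
have -> : l ^+ 2 * (h w / 8 - 204 * k ^+ 2 * I0) = l ^+ 2 * h w / 8 - 204 * I0 * (k * l) ^+ 2 by ring.
by rewrite kl expr1n; lra.
Qed.

End Harmonic.
End HarmonicBounds.

(** * Integrals over horizontal segments, and sums over the points of a layer *)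

Section LineBound.
Context {R : realType}.
Local Notation leb := (@lebesgue_measure R).
Local Notation leb2 := (leb \x leb)%E.
Local Notation U := (@upper_half_plane R).
Implicit Types (x y u : R) (z w : R * R).

(* Zero at [0] with slope [1], a double zero at [1], and so convex near [0] that
   [ramp2 >= 10 * ramp] there, which absorbs [cut2 >= - 10 * cut]. *)
Definition ramp u : R := u * (1 - u) ^+ 2 * (1 + 3 * u).
Definition ramp1 u : R := 1 + 2 * u - 15 * u ^+ 2 + 12 * u ^+ 3.
Definition ramp2 u : R := 2 - 30 * u + 36 * u ^+ 2.

Lemma der_ramp u : is_derive u 1 ramp (ramp1 u).
Proof.
apply: is_derive_eq (is_derive1M (is_derive1M (is_derive1I u) (is_derive1X 1 (is_derive1B (is_derive1C 1 u) (is_derive1I u))))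
  (is_derive1D (is_derive1C 1 u) (is_derive1M (is_derive1C 3 u) (is_derive1I u)))) _.
by rewrite /ramp1; ring.
Qed.

Lemma der_ramp1 u : is_derive u 1 ramp1 (ramp2 u).
Proof.
apply: is_derive_eq (is_derive1D (is_derive1B (is_derive1D (is_derive1C 1 u) (is_derive1M (is_derive1C 2 u) (is_derive1I u)))
  (is_derive1M (is_derive1C 15 u) (is_derive1X 1 (is_derive1I u)))) (is_derive1M (is_derive1C 12 u) (is_derive1X 2 (is_derive1I u)))) _.
by rewrite /ramp2; ring.
Qed.

Lemma ramp2_cont : continuous ramp2.
Proof.
move=> u; apply: continuous_atD; first apply: continuous_atB.
- exact: continuous_at_cst.
- by apply: continuous_atM; [exact: continuous_at_cst|exact: cvg_id].
- by apply: continuous_atM; [exact: continuous_at_cst|apply: continuous_atX; exact: cvg_id].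
Qed.

Lemma prod_test_jet (Q : set (R * R)) :
  jet Q (fun z => cut z.1 * ramp z.2) (fun z => cut1 z.1 * ramp z.2)
    (fun z => cut2 z.1 * ramp z.2) (fun z => cut z.1 * ramp1 z.2)
    (fun z => cut z.1 * ramp2 z.2).
Proof.
have c1 (f : R -> R) z : continuous f -> continuous_at z (fun z : R * R => f z.1).
  by move=> cf; apply: (@continuous_at_comp _ _ _ f fst); [exact: cvg_fst|exact: cf].
have c2 (f : R -> R) z : continuous f -> continuous_at z (fun z : R * R => f z.2).
  by move=> cf; apply: (@continuous_at_comp _ _ _ f snd); [exact: cvg_snd|exact: cf].
have cr : continuous ramp by move=> u; exact: is_derive1_continuous (der_ramp u).
move=> z _; split; split => /=.
- apply: is_derive_eq (is_derive1M (der_cut z.1) (is_derive1C (ramp z.2) z.1)) _; ring.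
- apply: is_derive_eq (is_derive1M (der_cut1 z.1) (is_derive1C (ramp z.2) z.1)) _; ring.
- apply: is_derive_eq (is_derive1M (is_derive1C (cut z.1) z.2) (der_ramp z.2)) _; ring.
- apply: is_derive_eq (is_derive1M (is_derive1C (cut z.1) z.2) (der_ramp1 z.2)) _; ring.
- by apply: continuous_atM; [apply: c1; exact: cut_cont|exact: c2].
- by apply: continuous_atM; [apply: c1; exact: cut2_cont|exact: c2].
- by apply: continuous_atM; [apply: c1; exact: cut_cont|apply: c2; exact: ramp2_cont].
Qed.

(** The left side is the negative of a Laplacian, the factor [s] coming from the horizontal scaling.
    Its being nonpositive for [z.2 < 1 / 30] is what makes the bound on segments uniform: near the
    lower side, which approaches the real axis, [h] is not charged at all. *)
Lemma prod_test_lap (s : R) z : 0 < s <= 1 -> -1 <= z.1 <= 1 -> 0 <= z.2 <= 1 ->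
  - (s * (cut2 z.1 * ramp z.2) + cut z.1 * ramp2 z.2) <=
  50 * (30^-1 <= z.2)%R%:R.
Proof.
case: z => x u /= /andP[s0 s1] xb ub.
have /andP[a0 a1] := cut_itv xb.
have cc : - (10 * cut x) <= cut2 x.
  have x2 : 0 <= x ^+ 2 <= 1 by rewrite sqr_ge0/=; case/andP: xb => *; nra.
  rewrite /cut /cut2; move: (x ^+ 2) x2 => t /andP[t0 t1].
  have -> : (1 - t) * (30 * t - 6) = - (10 * (1 - t) ^+ 3) +
    (1 - t) * (10 * t ^+ 2 + 10 * t + 4) by ring.
  rewrite lerDl mulr_ge0 ?subr_ge0//.
  by have := sqr_ge0 t; lra.
case/andP: ub => u0 u1.
have r0 : 0 <= ramp u by rewrite /ramp !mulr_ge0 ?sqr_ge0//; lra.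
have sc : - (10 * cut x) <= s * cut2 x by nra.
have H : - (s * (cut2 x * ramp u) + cut x * ramp2 u) <=
    cut x * (10 * ramp u - ramp2 u).
  have : - (10 * cut x) * ramp u <= s * cut2 x * ramp u by rewrite ler_wpM2r.
  lra.
have rE : ramp u = u + u ^+ 2 - 5 * u ^+ 3 + 3 * u ^+ 4 by rewrite /ramp; ring.
have u4 : u ^+ 4 <= u ^+ 3 by rewrite exprS ler_piMl ?exprn_ge0.
have u3 : 0 <= u ^+ 3 by rewrite exprn_ge0.
have u2 : u ^+ 2 <= u by rewrite expr2 ler_piMl.
have u20 := sqr_ge0 u.
have rr : ramp u <= u + u ^+ 2 by rewrite rE; lra.
apply: le_trans H _; case: (leP (30^-1) u) => hu /=.
  rewrite mulr1n mulr1; apply: (@le_trans _ _ (1 * 50)); last by rewrite mul1r.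
  have : 10 * ramp u - ramp2 u <= 50 by rewrite /ramp2; lra.
  by move=> h; apply: (@le_trans _ _ (cut x * 50)); [rewrite ler_wpM2l|rewrite ler_wpM2r].
rewrite mulr0n mulr0 mulr_ge0_le0// /ramp2.
have : u <= 1 / 30 by rewrite mul1r ltW.
lra.
Qed.

Lemma cut_ge_quarter x : - (1 / 2) <= x <= 1 / 2 -> 1 / 4 <= cut x.
Proof.
move=> /andP[x1 x2]; have : 3 / 4 <= 1 - x ^+ 2 by nra.
rewrite /cut; move: (1 - x ^+ 2) => p p34; have : 9 / 16 <= p ^+ 2 by nra.
by rewrite exprS; nra.
Qed.

Section Harmonic.
Context (h : R * R -> R) (hharm : harmonic_on U h).
Hypothesis h0 : forall z, U z -> 0 < h z.

(** On the lower side [ramp1 0 = 1], so the boundary term of [green_rect] is the integral to be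
    bounded, and by [prod_test_lap] the area term is at most the integral of [50 * h] over a
    rectangle that does not depend on [y]. *)
Lemma line_bound (Z : R) : 1 <= Z -> exists2 C : R, 0 <= C & forall y, 0 < y <= 2 ->
  (\int[leb]_(x in `[(- Z)%R, Z]) (h (x, y) * cut (x / Z))%:E <= C%:E)%E.
Proof.
move=> Z1; have hh := hharm; have hpos := h0.
(* For every lower side [e] in [(0, 2]], the heights between [e + 1 / 30] and [e + 1] lie in
   [[1 / 30, 3]]. *)
pose K := rect (- Z) Z 30^-1 3.
have KU : K `<=` U by exact: rect_upper.
have ZZ : - Z < Z by lra.
have Z0 : 0 < Z by lra.
have c3 : 30^-1 <= 3 :> R by lra.
have iK : leb2.-integrable K (EFin \o (fun z => 50 * h z)).
  apply: (integrable_rect (ltW ZZ) c3) => z /KU zU.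
  by apply: continuous_atM; [exact: continuous_at_cst|exact: harmonic_cont].
exists (fine (\int[leb2]_(z in K) (50 * h z)%:E)%E).
  by rewrite fine_ge0// integral_ge0// => z /KU /hpos hz; rewrite lee_fin mulr_ge0// ltW.
move=> e /andP[e0 e2].
rewrite fineK; last exact: (integrable_fin_num (measurable_rect _ _ _ _) iK).
pose Q := rect (- Z) Z e (e + 1).
have ee : e < e + 1 by rewrite ltrDl.
have QU : Q `<=` U by exact: rect_upper.
pose k := Z^-1.
have k0 : 0 < k by rewrite invr_gt0.
have kZ : k * Z = 1 by rewrite mulVf// gt_eqF.
have k1 : k <= 1 by rewrite invf_le1.
pose T z : R * R := (k * (z.1 - 0), 1 * (z.2 - e)).
have TQ z : Q z -> (-1 <= (T z).1 <= 1) /\ (0 <= (T z).2 <= 1).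
  move=> /rectP[/andP[z1 z2] /andP[z3 z4]]; rewrite /T/=; clear -kZ k0 z1 z2 z3 z4.
  by split; apply/andP; split; nra.
have jp := @jet_affine _ _ _ _ _ _ 0 e k 1 Q setT (fun _ _ => I) (prod_test_jet (Q := setT)).
have jh := jet_sub QU (harmonic_jet hh).
have s1 : (1 : R) ^+ 2 = 1 by rewrite expr1n.
have s2 : (-1 : R) ^+ 2 = 1 by rewrite sqrrN expr1n.
have ea : k * (- Z - 0) = -1 by rewrite -kZ; ring.
have eb : k * (Z - 0) = 1 by rewrite -kZ; ring.
have ec : 1 * (e - e) = 0 by ring.
have ed : 1 * (e + 1 - e) = 1 by ring.
have r0 : ramp 0 = 0 by rewrite /ramp !mul0r.
have r1 : ramp 1 = 0 by rewrite /ramp subrr; ring.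
have r11 : ramp1 1 = 0 by rewrite /ramp1; ring.
have r10 : ramp1 0 = 1 by rewrite /ramp1; ring.
have G := green_rect ZZ ee jh jp (fun z Qz => hh.2 _ (QU _ Qz)).
have -> : (\int[leb]_(x in `[(- Z)%R, Z]) (h (x, e) * cut (x / Z))%:E =
    \int[leb]_(x in `[(- Z)%R, Z]) (h (x, e) * (1 * (cut (k * (x - 0)) * ramp1 (1 * (e - e)))))%:E)%E.
  by apply: eq_integral => x _; rewrite ec r10 subr0 mulr1 mul1r (mulrC k).
rewrite -G; last 2 first.
- by move=> y _ /=; rewrite ea eb (cut_1 s1).1 (cut_1 s1).2 (cut_1 s2).1 (cut_1 s2).2 !mul0r !mulr0.
- by move=> x _ /=; rewrite ec ed r0 r1 r11 !mulr0.
have mQ : measurable Q by exact: measurable_rect.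
have mK : measurable K by exact: measurable_rect.
pose F : R * R -> \bar R := (EFin \o (fun z => 50 * h z)) \_ K.
apply: (@le_trans _ _ (\int[leb2]_(z in Q) F z)%E).
  apply: le_integral => //.
  - apply: (integrable_rect (ltW ZZ) (ltW ee)) => z Qz.
    apply: continuous_atN; apply: continuous_atM; first exact: (harmonic_cont hh (QU _ Qz)).
    by have [_ [_ p1 p2]] := jp _ Qz; exact: continuous_atD.
  - have iQK := integrableS mK (measurableI _ _ mQ mK) (@subIsetr _ _ _) iK.
    exact: ((integrable_restrict leb2 mK mQ _).1 iQK).
  - move=> z /set_mem Qz; have [t1 t2] := TQ _ Qz; have hz := hpos _ (QU _ Qz).
    have kk : 0 < k ^+ 2 <= 1 by rewrite exprn_gt0//= exprn_ile1// ltW.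
    have L := prod_test_lap kk t1 t2.
    have -> : F z = (50 * h z * (z \in K)%:R)%:E.
      by rewrite /F patchE; case: (z \in K); rewrite ?mulr1n ?mulr0n ?mulr1 ?mulr0.
    rewrite lee_fin.
    have zK : (30^-1 <= (T z).2)%R%:R <= (z \in K)%:R :> R.
      rewrite ler_nat; case: (leP (30^-1) (T z).2) => // hu; rewrite mem_set//.
      move: Qz => /rectP[z1 /andP[z3 z4]]; apply/rectP; split => //.
      by move: hu; rewrite /T/=; clear -z3 z4 e0 e2 => hu; apply/andP; split; lra.
    have L2 : h z * - (k ^+ 2 * (cut2 (T z).1 * ramp (T z).2) + cut (T z).1 * ramp2 (T z).2)
      <= h z * (50 * (z \in K)%:R).
      by rewrite ler_pM2l//; apply: le_trans L _; rewrite ler_pM2l.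
    by move: L2; rewrite /T/= expr1n; clear; lra.
rewrite -integral_mkcondr; apply: ge0_subset_integral => //.
- exact: measurableI.
- by case/integrableP: iK.
- by move=> z /KU /hpos hz; rewrite lee_fin mulr_ge0// ltW.
Qed.

(** [line_bound] integrated over heights in an interval of length [v]; the factor 4 comes from
    [cut >= 1 / 4] on the middle half. *)
Lemma strip_bound (Z : R) : 1 <= Z -> exists2 C : R, 0 <= C & forall v, 0 < v <= 1 ->
  (\int[leb2]_(z in rect (- (Z / 2)) (Z / 2) (v / 2) (3 * v / 2)) (h z)%:E
   <= (C * v)%:E)%E.
Proof.
move=> Z1; have [C C0 hC] := line_bound Z1.
exists (4 * C); first by rewrite mulr_ge0.
have hh := hharm; have hpos := h0.
move=> v /andP[v0 v1].
have ab : - (Z / 2) <= Z / 2 by lra.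
have cd : v / 2 <= 3 * v / 2 by lra.
have ch z : rect (- (Z / 2)) (Z / 2) (v / 2) (3 * v / 2) z -> {for z, continuous h}.
  by move=> Qz; apply: (harmonic_cont hh); apply: rect_upper Qz; rewrite divr_gt0.
rewrite (fubini_rect2 ab cd ch).
apply: (@le_trans _ _ (\int[leb]_(y in `[(v / 2)%R, (3 * v / 2)%R]) (4 * C)%:E)%E); last first.
  rewrite integral_cst//= lebesgue_measure_itv/= lte_fin; case: ifP => _.
    by rewrite -EFinB -EFinM lee_fin; lra.
  by rewrite mule0 lee_fin !mulr_ge0// ltW.
apply: ge0_le_integral => //.
- move=> y; rewrite /= in_itv/= => /andP[y1 _]; apply: integral_ge0 => x _.
  rewrite lee_fin ltW// hpos//; rewrite /upper_half_plane/=; clear -y1 v0; lra.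
- exact: (measurable_fubini_rect2 ab cd ch).
move=> y; rewrite /= in_itv/= => /andP[y1 y2].
have y02 : 0 < y <= 2 by apply/andP; split; lra.
have y0 : 0 < y by case/andP: y02.
have mh : measurable_fun (`[(- Z)%R, Z]) (fun x => (4 * (h (x, y) * cut (x / Z)))%:E).
  apply/measurable_EFinP.
  apply: subspace_continuous_measurable_fun => //.
  apply: continuous_subspaceT => x.
  apply: continuous_atM; first exact: continuous_at_cst.
  apply: continuous_atM.
    by apply: (@slice1_cont _ h); exact: (harmonic_cont hh).
  apply: (@continuous_at_comp _ _ _ cut (fun x => x / Z)); last exact: cut_cont.
  by apply: continuous_atM; [exact: cvg_id|exact: continuous_at_cst].
have cz x : - Z <= x <= Z -> 0 <= cut (x / Z).
  move=> /andP[x1 x2]; have Z0 : 0 < Z by lra.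
  have : -1 <= x / Z <= 1 by rewrite ler_pdivlMr// ler_pdivrMr// mulN1r mul1r x1 x2.
  by move=> /cut_itv /andP[].
have hp x : 0 < h (x, y) by apply: hpos.
have sub : `[(- (Z / 2))%R, (Z / 2)%R] `<=` `[(- Z)%R, Z].
  by move=> x; rewrite /= !in_itv/= => /andP[x1 x2]; clear -x1 x2 Z1; apply/andP; split; lra.
apply: (@le_trans _ _ (\int[leb]_(x in `[(- (Z / 2))%R, (Z / 2)%R]) (4 * (h (x, y) * cut (x / Z)))%:E)%E).
  apply: ge0_le_integral => //.
  - by move=> x _; rewrite lee_fin ltW.
  - apply/measurable_EFinP; apply: subspace_continuous_measurable_fun => //.
    apply: continuous_subspaceT => x; apply: (@slice1_cont _ h); exact: (harmonic_cont hh).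
  - exact: measurable_funS mh.
  - move=> x; rewrite /= in_itv/= => /andP[x1 x2]; rewrite lee_fin.
    have q : 1 / 4 <= cut (x / Z).
      have Z0 : 0 < Z by lra.
      apply: cut_ge_quarter.
      by rewrite ler_pdivlMr// ler_pdivrMr//; apply/andP; split; lra.
    by have := ler_wpM2l (ltW (hp x)) q; lra.
apply: (@le_trans _ _ (\int[leb]_(x in `[(- Z)%R, Z]) (4 * (h (x, y) * cut (x / Z)))%:E)%E).
  apply: ge0_subset_integral => //.
  move=> x; rewrite /= in_itv/= => xZ; rewrite lee_fin mulr_ge0// mulr_ge0 ?cz//.
  by rewrite ltW.
under eq_integral do rewrite EFinM.
rewrite ge0_integralZl//.
- by rewrite EFinM lee_pmul2l// ?lte_fin//; exact: hC.
- apply/measurable_EFinP; apply: subspace_continuous_measurable_fun => //.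
  apply: continuous_subspaceT => x; apply: continuous_atM.
    by apply: (@slice1_cont _ h); exact: (harmonic_cont hh).
  apply: (@continuous_at_comp _ _ _ cut (fun x => x / Z)); last exact: cut_cont.
  by apply: continuous_atM; [exact: cvg_id|exact: continuous_at_cst].
- move=> x; rewrite /= in_itv/= => xZ; rewrite lee_fin mulr_ge0 ?cz//.
  by rewrite ltW.
Qed.

(** The squares of half-side [v / 4] about the points are disjoint and lie in one strip. Summing
    [sub_mean] over them gives [(v / 4)^2 * \sum_i h w_i <= c * C * v]. *)
Lemma harmonic_sum_bound (X : R) : 0 <= X -> exists C : R,
  forall (v : R) (N : nat), 0 < v <= 1 -> N%:R * v <= X ->
  v * \sum_(i < N) h (i%:R * v, v) <= C.
Proof.
(* Half of this width is [X + 1], which leaves room for the last square to stick out beyond [X]. *)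
move=> X0; have Z1 : 1 <= 2 * X + 2 by lra.
have [C C0 hC] := strip_bound Z1; have hh := hharm; have hpos := h0.
have [c c0 hc] : exists2 c : R, 0 <= c & forall w l, 0 < l -> l < w.2 ->
    l ^+ 2 * h w <= c *
      \int[leb2]_(z in rect (w.1 - l) (w.1 + l) (w.2 - l) (w.2 + l)) h z.
  exists 1632; first exact: ler0n.
  by move=> w l; exact: (sub_mean hh hpos).
exists (16 * c * C) => v N v01 Nv; have /andP[v0 v1] := v01.
pose T := rect (- ((2 * X + 2) / 2)) ((2 * X + 2) / 2) (v / 2) (3 * v / 2).
pose Q (i : nat) := rect (i%:R * v - v / 4) (i%:R * v + v / 4) (v - v / 4) (v + v / 4).
have TU : T `<=` U by apply: rect_upper; rewrite divr_gt0.
have mQ i : measurable (Q i) by exact: measurable_rect.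
have mT : measurable T by exact: measurable_rect.
have QT (i : 'I_N) : Q i `<=` T.
  have iX : i%:R * v <= X.
    by apply: le_trans Nv; rewrite ler_pM2r// ler_nat ltnW.
  have i0 : 0 <= i%:R * v by rewrite mulr_ge0// ltW.
  move=> z /rectP[/andP[z1 z2] /andP[z3 z4]]; apply/rectP.
  by clear -iX i0 z1 z2 z3 z4 v0 v1; split; apply/andP; split; lra.
have iT : leb2.-integrable T (EFin \o h).
  apply: integrable_rect; [lra|lra|by move=> z /TU; exact: harmonic_cont].
have mhT : measurable_fun T (EFin \o h) by case/integrableP: iT.
have tQ : trivIset [set` enum 'I_N] (fun i : 'I_N => Q i).
  move=> i j _ _ [z [/rectP[/andP[z1 z2] _] /rectP[/andP[z3 z4] _]]].
  apply: val_inj => /=; apply/eqP; rewrite eqn_leq.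
  have aux (m n : nat) : m%:R * v - v / 4 <= n%:R * v + v / 4 -> (m <= n)%N.
    move=> mn; rewrite leqNgt; apply/negP; rewrite -(ler_nat R) -natr1.
    by clear -mn v0; nra.
  by apply/andP; split; apply: aux; [apply: le_trans z1 z4|apply: le_trans z3 z2].
have DT : \big[setU/set0]_(i <- enum 'I_N) Q i `<=` T.
  by rewrite -bigcup_seq => z [i _]; exact: QT.
have S : (\sum_(i < N) \int[leb2]_(z in Q i) (h z)%:E <= (C * v)%:E)%E.
  rewrite -big_enum.
  rewrite -(ge0_integral_bigsetU leb2 (F := fun i : 'I_N => Q i) (f := EFin \o h))//.
  - apply: le_trans (hC _ v01); apply: ge0_subset_integral => //.
      by apply: bigsetU_measurable.
    by move=> z /TU /hpos hz; rewrite lee_fin ltW.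
  - exact: enum_uniq.
  - exact: measurable_funS mhT.
  - by move=> z /DT /TU /hpos hz; rewrite lee_fin ltW.
have P (i : 'I_N) : (((v / 4) ^+ 2 * h (i%:R * v, v))%:E <= c%:E * \int[leb2]_(z in Q i) (h z)%:E)%E.
  have := hc (i%:R * v, v) (v / 4).
  move=> /(_ _ _)/wrap[||H].
  - by rewrite divr_gt0.
  - by rewrite /=; clear -v0; lra.
  have fi : (\int[leb2]_(z in Q i) (h z)%:E)%E \is a fin_num.
    apply: integrable_fin_num => //; exact: (integrableS mT (mQ i) (@QT i) iT).
  by rewrite -(fineK fi) -EFinM lee_fin.
have S2 : (v / 4) ^+ 2 * \sum_(i < N) h (i%:R * v, v) <= c * (C * v).
  rewrite -lee_fin mulr_sumr -sumEFin.
  apply: (@le_trans _ _ (\sum_(i < N) (c%:E * \int[leb2]_(z in Q i) (h z)%:E))%E).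
    by apply: lee_sum => i _; exact: P.
  rewrite -ge0_sume_distrr; last first.
    by move=> i _; apply: integral_ge0 => z /QT /TU /hpos hz; rewrite lee_fin ltW.
  rewrite [leRHS]EFinM; apply: lee_wpmul2l S; by rewrite lee_fin.
rewrite -(ler_pM2l v0); move: S2; move: (\sum_(i < N) _) => S0.
by clear; lra.
Qed.

End Harmonic.
End LineBound.

(** * Superharmonic series *)

Section SuperharmonicSeries.
Context {R : realType}.
Local Notation leb := (@lebesgue_measure R).
Local Notation U := (@upper_half_plane R).
Local Notation circ := [set` `[0%R, (2 * pi)%R]].
Implicit Types (z w : R * R) (f g : R * R -> R).

(** Nonnegativity is built in so that sums and series pass through circle means by monotone
    convergence; continuity makes the partial sums give lower semicontinuity in the limit. *)
Definition cont_superharmonic f : Prop :=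
  [/\ forall z, U z -> continuous_at z f, forall z, U z -> 0 <= f z &
      forall w r, 0 < r -> closed_disc w r `<=` U ->
        (circle_mean (EFin \o f) w r <= (f w)%:E)%E].

Lemma circle_point_upper w r t : closed_disc w r `<=` U -> U (circle_point w r t).
Proof.
apply; rewrite /closed_disc /circle_point/=.
have -> : (w.1 + r * cos t - w.1) ^+ 2 + (w.2 + r * sin t - w.2) ^+ 2 =
  r ^+ 2 * (cos t ^+ 2 + sin t ^+ 2) by ring.
by rewrite cos2Dsin2 mulr1.
Qed.

Lemma circle_center_upper w r : closed_disc w r `<=` U -> U w.
Proof. by apply; rewrite /closed_disc/= !subrr expr0n/= addr0 sqr_ge0. Qed.

Lemma circle_cont f w r : closed_disc w r `<=` U ->
  (forall z, U z -> continuous_at z f) ->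
  continuous (fun t : R => f (circle_point w r t)).
Proof.
move=> wU cf t; apply: (@continuous_at_comp _ _ _ f (circle_point w r)); last first.
  exact/cf/circle_point_upper.
apply: (@continuous_at_pair _ _ (fun t => w.1 + r * cos t) (fun t => w.2 + r * sin t)).
  by apply: continuous_atD; [exact: continuous_at_cst|apply: continuous_atM; [exact: continuous_at_cst|exact: continuous_cos]].
by apply: continuous_atD; [exact: continuous_at_cst|apply: continuous_atM; [exact: continuous_at_cst|exact: continuous_sin]].
Qed.

Lemma circle_measurable f w r : closed_disc w r `<=` U ->
  (forall z, U z -> continuous_at z f) ->
  measurable_fun circ (fun t : R => (f (circle_point w r t))%:E).
Proof.
move=> wU cf; apply/measurable_EFinP; apply: measurable_funTS.
by apply: continuous_measurable_fun; exact: circle_cont.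
Qed.

Let pi2_ge0 : (0 <= ((2 * pi)^-1 : R)%:E)%E.
Proof. by rewrite lee_fin invr_ge0 ltW// pi2_gt0. Qed.

Lemma cont_superharmonic0 : cont_superharmonic (fun=> 0).
Proof.
split=> // [z _|w r _ _]; first exact: cst_continuous.
by rewrite /circle_mean integral0_eq// mule0.
Qed.

Lemma cont_superharmonicD f g : cont_superharmonic f -> cont_superharmonic g ->
  cont_superharmonic (fun z => f z + g z).
Proof.
move=> [cf f0 mf] [cg g0 mg]; split => [z zU|z zU|w r r0 wU].
- by apply: continuous_atD; [exact: cf|exact: cg].
- by rewrite addr_ge0 ?f0 ?g0.
rewrite /circle_mean/=; under eq_integral do rewrite EFinD.
rewrite ge0_integralD//; last 4 first.
- by move=> t _; rewrite lee_fin f0//; exact: circle_point_upper.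
- exact: circle_measurable.
- by move=> t _; rewrite lee_fin g0//; exact: circle_point_upper.
- exact: circle_measurable.
rewrite ge0_muleDr; [|apply: integral_ge0 => t _..].
- by rewrite EFinD; apply: leeD; [exact: mf|exact: mg].
- by rewrite lee_fin f0//; exact: circle_point_upper.
- by rewrite lee_fin g0//; exact: circle_point_upper.
Qed.

Lemma cont_superharmonic_sum n (F : nat -> R * R -> R) :
  (forall i, cont_superharmonic (F i)) ->
  cont_superharmonic (fun z => \sum_(i < n) F i z).
Proof.
move=> hF; elim: n => [|n IH].
  have -> : (fun z => \sum_(i < 0) F i z) = fun=> 0.
    by apply/funext => z; rewrite big_ord0.
  exact: cont_superharmonic0.
have -> : (fun z => \sum_(i < n.+1) F i z) = fun z => \sum_(i < n) F i z + F n z.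
  by apply/funext => z; rewrite big_ord_recr.
exact: cont_superharmonicD.
Qed.

Lemma cont_superharmonic_bump x v d e : 0 < v -> 0 < d -> 0 < e <= v ^+ 2 ->
  cont_superharmonic (bump x v d e).
Proof.
move=> v0 d0 /andP[e0 ev]; split => [z zU|z zU|w r r0 wU].
- exact: bump_cont.
- exact/ltW/bump_gt0.
- by apply: circle_mean_bump => //; exact: closed_disc_upper.
Qed.

Lemma nneseries_gt_partial (u : nat -> \bar R) (a : R) : (forall n, 0 <= u n)%E ->
  (a%:E < \sum_(n <oo) u n)%E -> exists n, (a%:E < \sum_(0 <= i < n) u i)%E.
Proof.
move=> u0 au; apply: contrapT => /forallNP h.
suff : (\sum_(n <oo) u n <= a%:E)%E by rewrite leNgt au.
apply: lime_le; first exact: is_cvg_nneseries.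
by near=> n; rewrite leNgt; apply/negP/h.
Unshelve. all: by end_near. Qed.

Lemma superharmonic_nneseries (F : nat -> R * R -> R) :
  (forall n, cont_superharmonic (F n)) ->
  (exists2 z, U z & (\sum_(n <oo) (F n z)%:E < +oo)%E) ->
  superharmonic U (fun z => \sum_(n <oo) (F n z)%:E)%E.
Proof.
move=> hF hfin.
have cF n z : U z -> continuous_at z (F n) by have [+ _ _] := hF n; exact.
have F0 n z : U z -> 0 <= F n z by have [_ + _] := hF n; exact.
split => //.
(* In the subspace topology a point outside [U] is its own neighbourhood. Inside [U], a partial sum
   that exceeds [a] at [x] still does so nearby. *)
- move=> x a ax; have [xU|xU] := pselect (U x); last first.
    exists [set x]; last by move=> y ->.
    by case: (nbhs_subspaceP U x) => [/xU//|_ y].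
  have Fx n : (0 <= (F n x)%:E)%E by rewrite lee_fin F0.
  have [n an] := nneseries_gt_partial Fx ax.
  have [+ _ _] := @cont_superharmonic_sum n F hF.
  move=> /(_ x xU) cs.
  have ax' : a < \sum_(i < n) F i x by move: an; rewrite big_mkord sumEFin lte_fin.
  exists [set y | U y /\ a < \sum_(i < n) F i y].
    case: (nbhs_subspaceP U x) => // _; rewrite /within/=.
    have : nbhs (x : R * R) [set y | a < \sum_(i < n) F i y].
      exact: (cs _ (open_nbhs_nbhs (conj (@open_gt R a) ax'))).
    by apply: filterS => y.
  move=> y [yU ay]; apply: (@lt_le_trans _ _ (\sum_(0 <= i < n) (F i y)%:E)%E).
    by rewrite big_mkord sumEFin lte_fin.
  by apply: nneseries_lim_ge => i _ _; rewrite lee_fin F0.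
- move=> z zU; apply: (@lt_le_trans _ _ 0%E); first exact: ltNy0.
  by apply: nneseries_ge0 => n _ _; rewrite lee_fin F0.
- move=> w r r0 wU; rewrite /circle_mean.
  rewrite integral_nneseries//; last 2 first.
  + by move=> n; apply: circle_measurable => // z; exact: cF.
  + by move=> n t _; rewrite lee_fin F0//; exact: circle_point_upper.
  rewrite -nneseriesZl; last first.
    move=> n _ ; apply: integral_ge0 => t _; rewrite lee_fin F0//; exact: circle_point_upper.
  apply: lee_nneseries => [n _ _|n _].
    rewrite mule_ge0// integral_ge0// => t _; rewrite lee_fin F0//; exact: circle_point_upper.
  by have [_ _ +] := hF n; exact.
Qed.

End SuperharmonicSeries.

(** * Decreasing rearrangement of the weight *)

Section Levels.
Context {R : realType}.
Local Notation leb := (@lebesgue_measure R).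
Implicit Types (s : R -> R) (t u v : R).

Lemma decreasing_measurable s (a : R) :
  (forall t u, a <= t -> t <= u -> s u <= s t) ->
  measurable_fun `[a, +oo[ s.
Proof.
move=> sd; apply: (measurability _ (RGenOInfty.measurableE R)).
move=> _ [_ [x ->] <-]; apply: is_interval_measurable => p q.
move=> [ap sp] [aq sq] r /andP[pr rq].
have ap' : a <= p by move: ap; rewrite /= in_itv/= andbT.
have ar : a <= r by rewrite (le_trans ap').
split; first by rewrite /= in_itv/= andbT.
move: sq; rewrite /= !in_itv/= !andbT => /lt_le_trans; apply; exact: sd.
Qed.

(** The integral test, with [s 1] set aside. Starting the sums at [s 2] suits [levels], where the
    count [T i] is paired with the value of the weight at [T i + 1]. *)
Lemma sum_unbounded_of_integral s :
  (forall t, 0 < t -> 0 < s t) ->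
  (forall t u, 0 < t -> t <= u -> s u <= s t) ->
  (\int[leb]_(t in `[1%R, +oo[) (s t)%:E = +oo)%E ->
  forall M : R, exists K, M <= \sum_(l < K) s l.+2%:R.
Proof.
move=> s0 sd sint M; apply: contrapT => /forallNP hM.
have hM' K : \sum_(l < K) s l.+2%:R <= M by rewrite leNgt; apply/negP => h; apply: (hM K); exact: ltW.
have sd1 t u : 1 <= t -> t <= u -> s u <= s t.
  by move=> t1; apply: sd; exact: lt_le_trans t1.
pose F (k : nat) : set (measurableTypeR R) := `[k.+1%:R, k.+2%:R[%classic.
have FU : `[1%R, +oo[%classic = \bigcup_k F k.
  apply/seteqP; split => [t /=|t [k _]]; rewrite /F /= !in_itv/= ?andbT.
    move=> t1; exists (Num.truncn t).-1 => //; rewrite /F /= in_itv/=.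
    have t0 : 0 <= t by rewrite (le_trans _ t1).
    have tp : (0 < Num.truncn t)%N by rewrite truncn_gt0.
    by rewrite prednK//; exact: truncn_itv.
  by move=> /andP[k1 _]; apply: le_trans k1; rewrite ler1n.
have ms := decreasing_measurable sd1.
have P n : \sum_(i < n) s i.+1%:R <= s 1 + M.
  case: n => [|n]; last by rewrite big_ord_recl/= lerD2l; exact: hM'.
  by rewrite big_ord0 addr_ge0 ?(ltW (s0 _ ltr01))// (le_trans _ (hM' 0%N))// big_ord0.
have sumB : (\int[leb]_(t in `[1%R, +oo[) (s t)%:E <= (s 1 + M)%:E)%E.
  rewrite FU ge0_integral_bigcup//; last 4 first.
  - by move=> k; exact: measurable_itv.
  - by rewrite -FU; apply/measurable_EFinP.
  - move=> t; rewrite -FU /= in_itv/= andbT => t1; rewrite lee_fin ltW// s0//.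
    exact: lt_le_trans t1.
  - move=> i j _ _ [t []]; rewrite /F /= !in_itv/= => /andP[i1 i2] /andP[j1 j2].
    apply/eqP; rewrite eqn_leq.
    have h1 := le_lt_trans i1 j2; have h2 := le_lt_trans j1 i2.
    by move: h1 h2; rewrite !ltr_nat !ltnS => -> ->.
  have Fk k : (\int[leb]_(t in F k) (s t)%:E <= (s k.+1%:R)%:E)%E.
    apply: (@le_trans _ _ (\int[leb]_(t in F k) (s k.+1%:R)%:E)%E).
      apply: ge0_le_integral => //.
      - exact: measurable_itv.
      - move=> t; rewrite /F /= in_itv/= => /andP[t1 _]; rewrite lee_fin ltW// s0//.
        by apply: lt_le_trans t1; rewrite ltr0n.
      - apply/measurable_EFinP; apply: measurable_funS ms => //.
        by rewrite FU; exact: bigcup_sup.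
      - by move=> t; rewrite /F /= in_itv/= => /andP[t1 _]; rewrite lee_fin sd.
    rewrite integral_cst//=; last exact: measurable_itv.
    rewrite /F lebesgue_measure_itv/= lte_fin ltr_nat ltnSn.
    by rewrite -EFinB -EFinM lee_fin -[k.+2%:R]natr1 addrAC subrr add0r mulr1.
  apply: lime_le.
    apply: is_cvg_nneseries => n _ _; apply: integral_ge0 => t.
    rewrite /F /= in_itv/= => /andP[t1 _]; rewrite lee_fin ltW// s0//.
    by apply: lt_le_trans t1; rewrite ltr0n.
  near=> n; rewrite big_mkord.
  apply: (@le_trans _ _ (\sum_(i < n) (s i.+1%:R)%:E)%E).
    by apply: lee_sum => i _; exact: Fk.
  by rewrite sumEFin lee_fin.
by move: sumB; rewrite sint.
Unshelve. all: by end_near. Qed.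

Lemma count_lower (a : R) (N : nat) : a < N.+1%:R ->
  a - 1 <= (\sum_(i < N) (i.+1%:R <= a)%R)%N%:R.
Proof.
move=> aN; have [a0|a0] := leP 0 a; last by apply: (@le_trans _ _ 0) => //; lra.
have tN : (Num.truncn a <= N)%N.
  by rewrite -ltnS -(ltr_nat R); apply: le_lt_trans aN; rewrite truncn_le.
apply: (@le_trans _ _ (Num.truncn a)%:R).
  by rewrite lerBlDr natr1; exact/ltW/truncnS_gt.
rewrite ler_nat -[leqLHS]card_ord -sum1_card.
rewrite (big_ord_widen N (fun _ => 1%N) tN) big_mkcond/=.
apply: leq_sum => i _; case: ifP => // ia.
by rewrite -truncn_gt_nat ia.
Qed.

(** [T i] counts the [l] with [c v (i + 1) <= sg (l + 2)]. Exchanging the sums, each [l] is counted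
    about [sg (l + 2) / (c v)] times, so [v * \sum_i T i] is a lower approximation of the sum of the
    [sg (l + 2) / c]. *)
Lemma levels (sg : R -> R) (c : R) : 0 < c ->
  (forall t, 0 < t -> 0 < sg t) ->
  (forall t u, 0 < t -> t <= u -> sg u <= sg t) ->
  (forall M, exists K, M <= \sum_(l < K) sg l.+2%:R) ->
  forall M : R, exists2 v0 : R, 0 < v0 & forall v, 0 < v <= v0 ->
  exists NT : nat * (nat -> nat),
    [/\ forall i, (i < NT.1)%N -> c * v * i.+1%:R <= sg (NT.2 i).+1%:R,
        M <= v * \sum_(i < NT.1) (NT.2 i)%:R &
        NT.1%:R * (c * v) <= sg 2].
Proof.
(* The spare 1 pays for rounding: each of the [K] counts loses at most one, hence [v] after scaling,
   and [v <= 1 / (K + 1)]. *)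
move=> c0 s0 sd sK M; have [K hK] := sK (c * (M + 1)).
exists K.+1%:R^-1 => [|v /andP[v0 vK]]; first by rewrite invr_gt0.
have cv0 : 0 < c * v by rewrite mulr_gt0.
pose N := Num.truncn (sg 2 / (c * v)).
have sg2 : 0 < sg 2 by exact: s0.
pose T i : nat := (\sum_(l < K) ((c * v * i.+1%:R <= sg l.+2%:R)%R : nat))%N.
have Ncv : N%:R * (c * v) <= sg 2.
  by rewrite -ler_pdivlMr// truncn_le divr_ge0// ltW.
exists (N, T); split => //=.
- move=> i iN.
  have h2 : c * v * i.+1%:R <= sg 2.
    by apply: le_trans Ncv; rewrite mulrC ler_pM2r// ler_nat.
  rewrite leNgt; apply/negP => h.
  have T1 : (0 < T i)%N.
    rewrite lt0n; apply/eqP => T0; move: h; rewrite T0 ltNge; apply/negP; rewrite negbK.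
    apply: le_trans h2 _; apply: sd => //; by rewrite ler1n.
  (* If the inequality failed at [T i + 1], then by monotonicity no [l >= T i - 1] would be counted.
     The case [T i = 0] is excluded beforehand through [sg 2 <= sg 1]. *)
  have : (T i <= (T i).-1)%N.
    rewrite {1}/T.
    have E (l : 'I_K) : (((c * v * i.+1%:R <= sg l.+2%:R)%R : nat) <= (l < (T i).-1)%N)%N.
      case: (ltnP l (T i).-1) => [_|lT]; first exact: leq_b1.
      rewrite leqn0 eqb0 -ltNge; apply: le_lt_trans h.
      apply: sd => //; rewrite ler_nat.
      by rewrite ltnS -(prednK T1) ltnS.
    apply: (@leq_trans (\sum_(l < K) ((l < (T i).-1)%N : nat))%N).
      by apply: leq_sum => l _; exact: E.
    elim: (K) => [|k IH]; first by rewrite big_ord0.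
    rewrite big_ord_recr/=; case: ltnP => kT; last by rewrite addn0.
    apply: (@leq_trans k.+1) => //; rewrite addn1 ltnS.
    apply: (@leq_trans (\sum_(l < k) 1)%N); last by rewrite sum1_card card_ord.
    by apply: leq_sum => l _; exact: leq_b1.
  by rewrite -ltnS prednK// ltnn.
- rewrite -natr_sum exchange_big/= natr_sum mulr_sumr.
  have L (l : 'I_K) : sg l.+2%:R / c - v <= v * (\sum_(i < N) ((c * v * i.+1%:R <= sg l.+2%:R)%R : nat))%N%:R.
    have sl : sg l.+2%:R <= sg 2 by apply: sd => //; rewrite ler_nat.
    have aN : sg l.+2%:R / (c * v) < N.+1%:R.
      apply: le_lt_trans (_ : sg 2 / (c * v) < _); first by rewrite ler_pM2r ?invr_gt0.
      exact: truncnS_gt.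
    have := count_lower aN.
    have -> : (\sum_(i < N) ((i.+1%:R <= sg l.+2%:R / (c * v))%R : nat))%N =
       (\sum_(i < N) ((c * v * i.+1%:R <= sg l.+2%:R)%R : nat))%N.
      by apply: eq_bigr => i _; rewrite ler_pdivlMr// mulrC.
    rewrite -(ler_pM2l v0); apply: le_trans.
    rewrite le_eqVlt; apply/orP; left; apply/eqP; field.
    by rewrite !gt_eqF.
  apply: (@le_trans _ _ (\sum_(l < K) (sg l.+2%:R / c - v))); last by apply: ler_sum => l _; exact: L.
  rewrite sumrB -mulr_suml sumr_const card_ord -mulr_natr.
  have Kv : v * K%:R <= 1.
    apply: (@le_trans _ _ (K.+1%:R^-1 * K%:R)); first by rewrite ler_wpM2r.
    by rewrite mulrC ler_pdivrMr// mul1r ler_nat.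
  have : M + 1 <= (\sum_(l < K) sg l.+2%:R) / c by rewrite ler_pdivlMr// mulrC.
  lra.
Qed.

End Levels.

(** * The construction *)

Section Construction.
Context {R : realType}.
Local Notation U := (@upper_half_plane R).

(** In order: the heights, their separation, the control of level sets ([c * v j] being the length
    of the shadow of a square), the divergence that defeats majorants, and the confinement of all
    layers over one bounded interval. *)
Definition stages (c : R) (sg : R -> R) (v : nat -> R) (N : nat -> nat)
    (T : nat -> nat -> nat) : Prop :=
  [/\ forall j, 0 < v j <= 1,
      forall i j, (i < j)%N -> v j <= v i / 4,
      forall j i, (i < N j)%N -> c * v j * i.+1%:R <= sg (T j i).+1%:R,
      forall j, j%:R <= v j * \sum_(i < N j) (T j i)%:R &
      forall j, (N j)%:R * (c * v j) <= sg 2].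

Lemma stages_exist (sg : R -> R) (c : R) : 0 < c ->
  (forall t, 0 < t -> 0 < sg t) ->
  (forall t u, 0 < t -> t <= u -> sg u <= sg t) ->
  (forall M, exists K, M <= \sum_(l < K) sg l.+2%:R) ->
  exists v N T, stages c sg v N T.
Proof.
move=> c0 s0 sd sK.
have /choice[v0 hv0] : forall j : nat, exists v0 : R, 0 < v0 /\
  forall v, 0 < v <= v0 -> exists NT : nat * (nat -> nat),
    [/\ forall i, (i < NT.1)%N -> c * v * i.+1%:R <= sg (NT.2 i).+1%:R,
        j%:R <= v * \sum_(i < NT.1) (NT.2 i)%:R &
        NT.1%:R * (c * v) <= sg 2].
  by move=> j; have [v0 v00 h] := levels c0 s0 sd sK j%:R; exists v0.
pose v : nat -> R := nat_rect (fun=> R) (Num.min 1 (v0 0%N))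
  (fun j w => Num.min (w / 4) (v0 j.+1)).
have vS j : v j.+1 = Num.min (v j / 4) (v0 j.+1) by [].
have vpos j : 0 < v j.
  elim: j => [|j IH]; first by rewrite lt_min ltr01 (hv0 0%N).1.
  by rewrite vS lt_min divr_gt0// (hv0 j.+1).1.
have vv0 j : v j <= v0 j by case: j => [|j]; rewrite ?vS ge_min lexx orbT.
have v4 j : v j.+1 <= v j / 4 by rewrite vS ge_min lexx.
have vle j k : v (j + k)%N <= v j.
  elim: k => [|k IH]; first by rewrite addn0.
  by rewrite addnS; have := v4 (j + k)%N; have := vpos (j + k)%N; lra.
have v1 j : v j <= 1.
  by apply: le_trans (vle 0%N j) _; rewrite /v/= ge_min lexx.
have /choice[NT hNT] : forall j : nat, exists NT : nat * (nat -> nat),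
    [/\ forall i, (i < NT.1)%N -> c * v j * i.+1%:R <= sg (NT.2 i).+1%:R,
        j%:R <= v j * \sum_(i < NT.1) (NT.2 i)%:R &
        NT.1%:R * (c * v j) <= sg 2].
  by move=> j; apply: (hv0 j).2; rewrite vpos vv0.
exists v, (fun j => (NT j).1), (fun j => (NT j).2); split.
- by move=> j; rewrite vpos v1.
- move=> i j ij; rewrite -(subnKC ij); apply: le_trans (v4 i); exact: vle.
- by move=> j; have [+ _ _] := hNT j; exact.
- by move=> j; have [_ + _] := hNT j; exact.
- by move=> j; have [_ _ +] := hNT j; exact.
Qed.

(** * The sum of the layers *)

Section Potential.
Context (v : nat -> R) (N : nat -> nat) (T : nat -> nat -> nat).
Hypothesis v01 : forall j, 0 < v j <= 1.
Hypothesis v4 : forall i j, (i < j)%N -> v j <= v i / 4.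

(** The [74] is that of [bump_le_far]: the [N j] tails of a layer add up to at most [2^-(j + 1)],
    hence all tails together to at most 1. The successor of [N j] keeps the inverse meaningful for
    an empty layer. *)
Definition weight j : R := (74 * (N j).+1%:R * 2 ^+ j.+1)^-1.

Definition block j i : R * R -> R :=
  bump (i%:R * v j) (v j) (weight j)
    (9 * v j ^+ 2 * expR (- ((T j i)%:R / weight j + 4))).

Definition layer j z : R := \sum_(i < N j) block j i z.

Definition potential z : \bar R := (\sum_(j <oo) (layer j z)%:E)%E.

Definition box j i : set (R * R) :=
  [set z | `|z.1 - i%:R * v j| < v j / 2 /\ `|z.2 - v j| < v j / 2].

Lemma weight_gt0 j : 0 < weight j.
Proof. by rewrite invr_gt0 !mulr_gt0// exprn_gt0. Qed.

Lemma v_gt0 j : 0 < v j.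
Proof. by have /andP[] := v01 j. Qed.

Lemma weight_sum j : (N j)%:R * (74 * weight j) <= 2^-1 ^+ j.+1.
Proof.
rewrite /weight; have p2 : 0 < (2 : R) ^+ j.+1 by rewrite exprn_gt0.
have -> : (N j)%:R * (74 * (74 * (N j).+1%:R * 2 ^+ j.+1)^-1) =
   (N j)%:R / (N j).+1%:R * (2 ^+ j.+1)^-1 :> R.
  by field; rewrite !gt_eqF.
by rewrite exprVn ler_piMl ?invr_ge0 ?(ltW p2)// ler_pdivrMr// mul1r ler_nat.
Qed.

Lemma block_eps j i :
  0 < 9 * v j ^+ 2 * expR (- ((T j i)%:R / weight j + 4)) <= v j ^+ 2.
Proof. by apply: bump_eps; [exact: v_gt0|exact: weight_gt0|exact: ler0n]. Qed.

Lemma block_superharmonic j i : cont_superharmonic (block j i).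
Proof.
by apply: cont_superharmonic_bump; [exact: v_gt0|exact: weight_gt0|exact: block_eps].
Qed.

Lemma block_gt0 j i z : U z -> 0 < block j i z.
Proof.
have /andP[e0 e1] := block_eps j i.
by apply: bump_gt0 => //; [exact: v_gt0|exact: weight_gt0].
Qed.

Lemma layer_ge0 j z : U z -> 0 <= layer j z.
Proof. by move=> zU; apply: sumr_ge0 => i _; exact/ltW/block_gt0. Qed.

Lemma block_le j i z : U z ->
  block j i z <= 74 * weight j + (z \in box j i)%:R * (T j i)%:R.
Proof.
move=> zU; have w0 := weight_gt0 j; have /andP[e0 e1] := block_eps j i.
have [zB|zB] := pselect (box j i z); last first.
  rewrite memNset// mul0r addr0; apply: bump_le_far => //; exact: v_gt0.
rewrite mem_set// mul1r; have [b1 b2] := zB.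
apply: (@le_trans _ _ ((T j i)%:R + 5 * weight j)); last by lra.
by apply: bump_le_near => //; exact: v_gt0.
Qed.

Lemma block_center j i : (T j i)%:R <= block j i (i%:R * v j, v j).
Proof. by apply: bump_center; [exact: v_gt0|exact: weight_gt0]. Qed.

(** Between layers the heights decide: [3 v' / 2 <= 3 v / 8 < v / 2] when [v' <= v / 4]. Within a
    layer the centres are at least [v] apart. *)
Lemma box_disjoint j i j' i' z : box j i z -> box j' i' z -> (j = j') /\ (i = i').
Proof.
have vp := v_gt0; have vq := v4.
have lvl k l a b : box k a z -> box l b z -> ~ (k < l)%N.
  move=> [_]; rewrite ltr_norml => /andP[p1 _] [_]; rewrite ltr_norml => /andP[_ p2] kl.
  by have := vq _ _ kl; have := vp k; have := vp l; lra.
move=> B B'; have jj : j = j'.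
  by case: (ltngtP j j') => // [/(lvl _ _ _ _ B B')|/(lvl _ _ _ _ B' B)].
subst j'; split => //.
have idx a b : box j a z -> box j b z -> ~ (a < b)%N.
  move=> [+ _]; rewrite ltr_norml => /andP[_ p1] [+ _]; rewrite ltr_norml => /andP[p2 _] ab.
  have ab' : (a%:R : R) + 1 <= b%:R by rewrite natr1 ler_nat.
  have := vp j; have : (a%:R + 1) * v j <= b%:R * v j by rewrite ler_pM2r.
  lra.
by case: (ltngtP i i') => // [/(idx _ _ B B')|/(idx _ _ B' B)].
Qed.

Lemma geo_sum n : \sum_(j < n) (2^-1 : R) ^+ j.+1 <= 1.
Proof.
have -> : \sum_(j < n) (2^-1 : R) ^+ j.+1 = 1 - 2^-1 ^+ n.
  elim: n => [|n IH]; first by rewrite big_ord0 expr0 subrr.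
  by rewrite big_ord_recr/= IH exprS; field.
by rewrite gerBl exprn_ge0.
Qed.

(** The 1 bounds all the tails together; beyond them, [z] meets at most one peak because the boxes
    are disjoint. *)
Lemma potential_le z : U z ->
  (potential z <= 1)%E \/
  exists j i, [/\ (i < N j)%N, box j i z & (potential z <= (1 + (T j i)%:R)%:E)%E].
Proof.
move=> zU.
pose b j : R := \sum_(i < N j) (z \in box j i)%:R * (T j i)%:R.
have lb j : layer j z <= 2^-1 ^+ j.+1 + b j.
  apply: (@le_trans _ _ (\sum_(i < N j) (74 * weight j + (z \in box j i)%:R * (T j i)%:R))).
    by apply: ler_sum => i _; exact: block_le.
  rewrite big_split/= lerD2r sumr_const card_ord -[_ *+ _]mulr_natl; exact: weight_sum.
have pot (B : R) : (forall n, \sum_(j < n) b j <= B) -> (potential z <= (1 + B)%:E)%E.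
  move=> hB; apply: lime_le.
    by apply: is_cvg_nneseries => n _ _; rewrite lee_fin layer_ge0.
  near=> n; rewrite big_mkord sumEFin lee_fin.
  apply: (@le_trans _ _ (\sum_(j < n) (2^-1 ^+ j.+1 + b j))).
    by apply: ler_sum => j _; exact: lb.
  by rewrite big_split/=; apply: lerD; [exact: geo_sum|exact: hB].
have [[j [i [iN zB]]]|none] := pselect (exists j i, (i < N j)%N /\ box j i z).
  right; exists j, i; split => //; apply: pot => n.
  have bE k : b k <= (k == j)%:R * (T j i)%:R.
    have [->|kj] := eqVneq k j.
      rewrite mul1r /b (bigD1 (Ordinal iN))//= mem_set// mul1r big1 ?addr0// => a ai.
      rewrite memNset ?mul0r// => aB; move/eqP: ai; apply.
      by apply: val_inj; have [_ ai] := box_disjoint aB zB.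
    rewrite mul0r /b big1// => a _; rewrite memNset ?mul0r// => aB.
    by have [kj' _] := box_disjoint aB zB; rewrite kj' eqxx in kj.
  apply: (@le_trans _ _ (\sum_(k < n) (val k == j)%:R * (T j i)%:R)).
    by apply: ler_sum => k _; exact: bE.
  rewrite -mulr_suml ler_piMl// -natr_sum -[leRHS]/(1%:R) ler_nat.
  have [jn|jn] := ltnP j n.
    rewrite (bigD1 (Ordinal jn))//= eqxx big1 ?addn0// => k kj.
    by apply/eqP; rewrite eqb0; apply: contra kj => /eqP kj; apply/eqP/val_inj.
  rewrite big1// => k _; apply/eqP; rewrite eqb0; apply/eqP => kj.
  by have := ltn_ord k; rewrite kj ltnNge jn.
left; have := pot 0; rewrite addr0; apply => n.
rewrite big1// => j _; rewrite /b big1// => i _; rewrite memNset ?mul0r// => zB.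
by apply: none; exists j, i.
Unshelve. all: by end_near. Qed.

Lemma potential_ge_layer j z : U z -> ((layer j z)%:E <= potential z)%E.
Proof.
move=> zU; apply: (@le_trans _ _ (\sum_(0 <= k < j.+1) (layer k z)%:E)%E).
  rewrite big_mkord sumEFin lee_fin big_ord_recr/= lerDr.
  by apply: sumr_ge0 => k _; exact: layer_ge0.
by apply: nneseries_lim_ge => k _ _; rewrite lee_fin layer_ge0.
Qed.

Lemma potential_ge_block j i z : (i < N j)%N -> U z ->
  ((block j i z)%:E <= potential z)%E.
Proof.
move=> iN zU; apply: le_trans (potential_ge_layer j zU); rewrite lee_fin.
rewrite /layer (bigD1 (Ordinal iN))//= lerDl.
by apply: sumr_ge0 => k _; exact/ltW/block_gt0.
Qed.

Lemma potential_superharmonic : superharmonic U potential.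
Proof.
apply: superharmonic_nneseries.
  by move=> j; apply: cont_superharmonic_sum => i; exact: block_superharmonic.
exists (0, 1); first exact: ltr01.
have [/le_lt_trans|[j [i [_ _ /le_lt_trans]]]] := @potential_le (0, 1) ltr01.
  by apply; exact: ltry.
by apply; exact: ltry.
Qed.

End Potential.

(** For [t >= 1] the tails alone cannot exceed [t], so the cone over [xi] meets a box with
    [t < T j i + 1]. The box lies below height [3 v / 2], so [xi] is within
    [v / 2 + 3 alpha v / 2 = c v / 2] of [i v]; and [c v (i + 1) <= sg (T j i + 1) <= sg t]. *)
Lemma level_set_sub (alpha c : R) (sg : R -> R) v N T (t xi : R) :
  0 < alpha -> c = 1 + 3 * alpha -> stages c sg v N T ->
  (forall t u, 0 < t -> t <= u -> sg u <= sg t) -> 1 <= t ->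
  (t%:E < nontangential_max alpha (potential v N T) xi)%E ->
  - sg t / 2 <= xi <= sg t.
Proof.
move=> a0 cE [v01 v4 hT _ _] sd t1 /ereal_sup_gt[_ [z [zU /= zx] <-]] tz.
have [p1|[j [i [iN [b1 b2] p]]]] := potential_le N T v01 v4 zU.
  by have := lt_le_trans tz p1; rewrite lte_fin ltNge t1.
have tT : t < (T j i).+1%:R by have := lt_le_trans tz p; rewrite lte_fin addrC natr1.
have sT : sg (T j i).+1%:R <= sg t by apply: sd; [exact: lt_le_trans t1|exact: ltW].
have H := le_trans (hT j i iN) sT.
have v0 := v_gt0 v01 j.
have iv0 : 0 <= i%:R * v j by rewrite mulr_ge0// ltW.
have H1 : c * v j + c * (i%:R * v j) <= sg t.
  by apply: le_trans H; rewrite -natr1; lra.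
have c1 : i%:R * v j <= c * (i%:R * v j) by rewrite ler_peMl// cE; lra.
have c2 : 0 <= c * (i%:R * v j) by apply: le_trans c1.
have zv : alpha * z.2 <= alpha * (3 * v j / 2).
  by rewrite ler_pM2l//; move: b2; rewrite ltr_norml => /andP[_]; lra.
have cvE : c * v j = v j + 3 * (alpha * v j) by rewrite cE; ring.
have av0 : 0 < alpha * v j by rewrite mulr_gt0.
move: zx b1; rewrite ler_norml ltr_norml => /andP[x1 x2] /andP[x3 x4].
clear -H1 c1 c2 zv cvE x1 x2 x3 x4 v0 iv0 av0.
by apply/andP; split; lra.
Qed.

(** At the centres [h >= T j i], so [j <= v j * \sum_i h w_i <= C] for every [j], with [C] depending
    only on [h] and on the bound [sg 2 / c] for [N j * v j]. *)
Lemma no_harmonic_majorant (c : R) (sg : R -> R) v N T : 0 < c ->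
  0 <= sg 2 -> stages c sg v N T ->
  ~ exists h : R * R -> R, harmonic_on U h /\
      forall z, U z -> (potential v N T z <= (h z)%:E)%E.
Proof.
move=> c0 sg0 [v01 v4 _ hM hN] [h [hh hpot]].
have h0 z : U z -> 0 < h z.
  (* Layer 0 may be empty, as only [0 <= v 0 * \sum_i T] is asked of it; layer 1 is not. *)
  move=> zU; have N0 : (0 < N 1)%N.
    rewrite lt0n; apply/eqP => N0; have := hM 1%N.
    move: (v 1%N) => w; rewrite N0 big_ord0 mulr0 ler10//.
  rewrite -lte_fin; apply: lt_le_trans (hpot _ zU).
  apply: lt_le_trans (potential_ge_block T v01 N0 zU).
  by rewrite lte_fin; exact: block_gt0.
have X0 : 0 <= sg 2 / c by rewrite divr_ge0// ltW.
have [C hC] := harmonic_sum_bound hh h0 X0.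
pose j := (Num.truncn C).+1.
have Cj : C < j%:R by exact: truncnS_gt.
have /andP[v0 v1] := v01 j.
have NX : (N j)%:R * v j <= sg 2 / c.
  by rewrite ler_pdivlMr// -mulrA [v j * c]mulrC; exact: hN.
have := hC (v j) (N j) (v01 j) NX; apply/negP; rewrite -ltNge.
apply: lt_le_trans Cj _; apply: le_trans (hM j) _.
rewrite ler_pM2l//; apply: ler_sum => i _.
have wU : U (i%:R * v j, v j) by exact: v0.
rewrite -lee_fin; apply: le_trans (hpot _ wU).
apply: le_trans (potential_ge_block T v01 (ltn_ord i) wU).
by rewrite lee_fin; exact: block_center.
Qed.

(** Monotonicity of the underlying outer measure, valid for arbitrary sets and so for the level sets
    of the maximal function as they stand. *)
Lemma lebesgue_measure_subset (A B : set R) : A `<=` B ->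
  (lebesgue_measure A <= lebesgue_measure B)%E.
Proof.
move=> AB; rewrite /lebesgue_measure /lebesgue_stieltjes_measure /measure_extension.
exact: (@le_mu_ext _ (ocitv_type R) R (wlength idfun) A B AB).
Qed.

End Construction.

Theorem proposition4 (R : realType) (alpha : R) (halpha : 0 < alpha)
  (s : R -> R)
  (s_gt0 : forall t, 0 < t -> 0 < s t)
  (s_decr : forall t u, 0 < t -> t <= u -> s u <= s t)
  (s_lim : s t @[t --> +oo] --> (0 : R))
  (s_int : (\int[lebesgue_measure]_(t in `[1%R, +oo[) (s t)%:E = +oo)%E) :
  exists phi : R * R -> \bar R,
    [/\ superharmonic upper_half_plane phi,
        (forall z, upper_half_plane z -> (0 < phi z)%E),
        (\forall t \near +oo,
           (lebesgue_measure
              [set xi : R | t%:E < nontangential_max alpha phi xi]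
            <= (s t)%:E)%E) &
        ~ exists h : R * R -> R,
            harmonic_on upper_half_plane h /\
            (forall z, upper_half_plane z -> (phi z <= (h z)%:E)%E)].
Proof.
(* Halving [s] makes room for the overhang on the left: the interval [[- sg t / 2, sg t]] has length
   [3 s t / 4]. *)
pose sg t := s t / 2; pose c : R := 1 + 3 * alpha.
have c0 : 0 < c by rewrite /c; lra.
have sg0 t : 0 < t -> 0 < sg t by move=> /s_gt0 st; rewrite divr_gt0.
have sgd t u : 0 < t -> t <= u -> sg u <= sg t.
  by move=> t0 tu; rewrite ler_pM2r ?invr_gt0//; exact: s_decr.
have sgK M : exists K, M <= \sum_(l < K) sg l.+2%:R.
  have [K hK] := sum_unbounded_of_integral s_gt0 s_decr s_int (2 * M).
  by exists K; rewrite -mulr_suml; lra.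
have [v [N [T st]]] := stages_exist c0 sg0 sgd sgK.
have [v01 v4 _ hM _] := st.
exists (potential v N T); split.
- exact: potential_superharmonic.
- move=> z zU; have N0 : (0 < N 1)%N.
    rewrite lt0n; apply/eqP => N0; have := hM 1%N.
    by rewrite N0 big_ord0 mulr0 ler10.
  apply: lt_le_trans (potential_ge_block T v01 N0 zU).
  by rewrite lte_fin; exact: block_gt0.
- near=> t; have t1 : 1 <= t by near: t; exact: nbhs_pinfty_ge.
  have st0 : 0 < sg t by apply: sg0; exact: lt_le_trans t1.
  apply: (@le_trans _ _ (lebesgue_measure `[- sg t / 2, sg t])).
    apply: lebesgue_measure_subset => xi /= h.
    by rewrite in_itv/=; exact: (level_set_sub halpha (erefl c) st sgd t1 h).
  rewrite lebesgue_measure_itv/= lte_fin; case: ifP => _.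
    by rewrite -EFinB lee_fin; move: st0; rewrite /sg; lra.
  by rewrite lee_fin ltW// s_gt0//; exact: lt_le_trans t1.
- by apply: (@no_harmonic_majorant _ c sg) => //; exact/ltW/sg0.
Unshelve. all: by end_near. Qed.
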